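(* Let $S_1$ and $S_2$ be linear relations in $\mathbb C^m$. Then the Weyr characteristics of $S_1$ and $S_2$ coincide if and only if $S_1$ and $S_2$ are strictly equivalent.
   Context: **Linear relations.** A linear relation in a finite-dimensional complex vector space $X$ is a linear subspace $S$ of $X\times X$. Put $\operatorname{dom}S=\{x:(x,y)\in S \text{ for some }y\}$, $R(S)=\{y:(x,y)\in S\text{ for some }x\}$, $N(S)=\{x:(x,0)\in S\}$, $\operatorname{mul}(S)=\{y:(0,y)\in S\}$, $S-\lambda=\{(x,y-\lambda x):(x,y)\in S\}$ for $\lambda\in\mathbb C$. The product is $S_1S_2=\{(x,z): (x,y)\in S_2,\ (y,z)\in S_1\text{ for some }y\}$; $S^0=I$ is the identity relation and $S^k=S\cdot S^{k-1}$. For $\lambda\in\mathbb C$ let $\mathcal R_\lambda(S)=\bigcup_{k}N((S-\lambda)^k)$, $\mathcal R_\infty(S)=\bigcup_k\operatorname{mul}(S^k)$, and $\mathcal R_c(S)=\mathcal R_0(S)\cap\mathcal R_\infty(S)$. A number $\lambda\in\mathbb C$ is an eigenvalue of $S$ if $N(S-\lambda)\ne\{0\}$, and $\infty$ is an eigenvalue if $\operatorname{mul}(S)\neq\{0\}$; an eigenvalue $\lambda\in\mathbb C\cup\{\infty\}$ is proper if $\mathcal R_\lambda(S)\not\subset\mathcal R_c(S)$. **Weyr characteristic of a linear relation.** For $k\ge1$ and $\lambda\in\mathbb C$ set $$W_k(S,\lambda)=\dim\frac{N((S-\lambda)^k)+\mathcal R_c(S)}{N((S-\lambda)^{k-1})+\mathcal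 R_c(S)},\quad A_k=\dim\frac{\operatorname{mul}(S^k)+\mathcal R_c(S)}{\operatorname{mul}(S^{k-1})+\mathcal R_c(S)},\quad B_k=\dim\frac{N(S^k)\cap\mathcal R_c(S)}{N(S^{k-1})\cap\mathcal R_c(S)},$$ $$C_1=\dim\frac{R(S)+\operatorname{dom}S}{R(S)+\mathcal R_0(S)},\qquad C_k=\dim\frac{R(S^{k})+\mathcal R_0(S)}{R(S^{k+1})+\mathcal R_0(S)}\quad(k\ge2).$$ These sequences are non-increasing and eventually zero; they are regarded as finite sequences by omitting zero entries (possibly empty). $W$ is the collection of the sequences $W(\lambda)=(W_k(S,\lambda))_k$ indexed by the finite proper eigenvalues $\lambda$ of $S$, and $(W,A,B,C)$ with $A=(A_k)$, $B=(B_k)$, $C=(C_k)$ is the Weyr characteristic of $S$. Two linear relations have coinciding Weyr characteristics if they have the same finite proper eigenvalues, the same sequence $W(\lambda)$ at each of them, and the same sequences $A$, $B$, $C$. **Strict equivalence.** Linear relations $S_1,S_2$ in $\mathbb C^m$ are strictly equivalent if there is an invertible $T\in\mathbb C^{m\times m}$ with $S_2=\{(Tx,Ty):(x,y)\in S_1\}$. *)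

(* Defs.v *)
From HB Require Import structures.
From mathcomp Require Import all_boot all_order all_algebra.
From mathcomp Require Export reals complex.
Set Implicit Arguments.
Unset Strict Implicit.
Unset Printing Implicit Defensive.
Import GRing.Theory.
Local Open Scope ring_scope.

Definition linrel (K : fieldType) (X : vectType K) : Type :=
  {vspace (X * X)%type}.

Definition lr_dom (K : fieldType) (X : vectType K) (S : linrel X) : {vspace X} :=
  (linfun fst @: S)%VS.

Definition lr_ran (K : fieldType) (X : vectType K) (S : linrel X) : {vspace X} :=
  (linfun snd @: S)%VS.

Definition lr_ker (K : fieldType) (X : vectType K) (S : linrel X) : {vspace X} :=
  (linfun fst @: (S :&: lker (linfun snd)))%VS.

Definition lr_mul (K : fieldType) (X : vectType K) (S : linrel X) : {vspace X} :=
  (linfun snd @: (S :&: lker (linfun fst)))%VS.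

Definition shear (K : fieldType) (X : vectType K) (l : K) (p : X * X) : X * X :=
  (p.1, p.2 - l *: p.1).

Fact shear_is_linear (K : fieldType) (X : vectType K) (l : K) :
  linear (@shear K X l).
Proof.
move=> a [x y] [x' y']; congr pair => /=.
by rewrite scalerDr !scalerA mulrC -scalerA opprD addrACA scalerBr scalerA.
Qed.
HB.instance Definition _ (K : fieldType) (X : vectType K) (l : K) :=
  GRing.isLinear.Build K (X * X)%type (X * X)%type _ (@shear K X l)
    (@shear_is_linear K X l).

Definition lr_sub (K : fieldType) (X : vectType K) (S : linrel X) (l : K) :
    linrel X :=
  (linfun (shear l) @: S)%VS.

Definition diagv (K : fieldType) (X : vectType K) (x : X) : X * X := (x, x).

Fact diagv_is_linear (K : fieldType) (X : vectType K) : linear (@diagv K X).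
Proof. by []. Qed.
HB.instance Definition _ (K : fieldType) (X : vectType K) :=
  GRing.isLinear.Build K X (X * X)%type _ (@diagv K X) (@diagv_is_linear K X).

Definition lr_id (K : fieldType) (X : vectType K) : linrel X :=
  limg (linfun (@diagv K X)).

Definition proj12 (K : fieldType) (X : vectType K) (t : X * X * X) : X * X :=
  (t.1.1, t.1.2).
Definition proj23 (K : fieldType) (X : vectType K) (t : X * X * X) : X * X :=
  (t.1.2, t.2).
Definition proj13 (K : fieldType) (X : vectType K) (t : X * X * X) : X * X :=
  (t.1.1, t.2).

Fact proj12_is_linear (K : fieldType) (X : vectType K) : linear (@proj12 K X).
Proof. by []. Qed.
Fact proj23_is_linear (K : fieldType) (X : vectType K) : linear (@proj23 K X).
Proof. by []. Qed.
Fact proj13_is_linear (K : fieldType) (X : vectType K) : linear (@proj13 K X).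
Proof. by []. Qed.
HB.instance Definition _ (K : fieldType) (X : vectType K) :=
  GRing.isLinear.Build K (X * X * X)%type (X * X)%type _ (@proj12 K X)
    (@proj12_is_linear K X).
HB.instance Definition _ (K : fieldType) (X : vectType K) :=
  GRing.isLinear.Build K (X * X * X)%type (X * X)%type _ (@proj23 K X)
    (@proj23_is_linear K X).
HB.instance Definition _ (K : fieldType) (X : vectType K) :=
  GRing.isLinear.Build K (X * X * X)%type (X * X)%type _ (@proj13 K X)
    (@proj13_is_linear K X).

(* The product S1 S2: S2 is applied first. *)
Definition lr_comp (K : fieldType) (X : vectType K) (S1 S2 : linrel X) :
    linrel X :=
  (linfun (@proj13 K X) @:
     (linfun (@proj12 K X) @^-1: S2 :&: linfun (@proj23 K X) @^-1: S1))%VS.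

Fixpoint lr_exp (K : fieldType) (X : vectType K) (S : linrel X) (k : nat) :
    linrel X :=
  if k is k'.+1 then lr_comp S (lr_exp S k') else lr_id X.

(* The unions over k of N((S - l)^k) and of mul(S^k) are unions of ascending
   chains which are constant from k = dim X on; see mem_lr_root and
   mem_lr_root_inf below. *)
Definition lr_root (K : fieldType) (X : vectType K) (S : linrel X) (l : K) :
    {vspace X} :=
  lr_ker (lr_exp (lr_sub S l) (\dim {:X})).

Definition lr_root_inf (K : fieldType) (X : vectType K) (S : linrel X) :
    {vspace X} :=
  lr_mul (lr_exp S (\dim {:X})).

Definition lr_root_c (K : fieldType) (X : vectType K) (S : linrel X) :
    {vspace X} :=
  (lr_root S 0 :&: lr_root_inf S)%VS.

Definition lr_eigenvalue (K : fieldType) (X : vectType K) (S : linrel X)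
    (l : K) : bool :=
  lr_ker (lr_sub S l) != 0%VS.

Definition lr_proper_eigenvalue (K : fieldType) (X : vectType K)
    (S : linrel X) (l : K) : bool :=
  lr_eigenvalue S l && ~~ (lr_root S l <= lr_root_c S)%VS.

(* dim (U / V) for V a subspace of U: U :\: V is a complement of U :&: V = V
   in U. *)
Definition qdim (K : fieldType) (X : vectType K) (U V : {vspace X}) : nat :=
  \dim (U :\: V).

(* The entries W_k(S, l), A_k, B_k, C_k, meaningful for k >= 1. *)
Definition weyrW_nth (K : fieldType) (X : vectType K) (S : linrel X) (l : K)
    (k : nat) : nat :=
  qdim (lr_ker (lr_exp (lr_sub S l) k) + lr_root_c S)
       (lr_ker (lr_exp (lr_sub S l) k.-1) + lr_root_c S).

Definition weyrA_nth (K : fieldType) (X : vectType K) (S : linrel X)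
    (k : nat) : nat :=
  qdim (lr_mul (lr_exp S k) + lr_root_c S)
       (lr_mul (lr_exp S k.-1) + lr_root_c S).

Definition weyrB_nth (K : fieldType) (X : vectType K) (S : linrel X)
    (k : nat) : nat :=
  qdim (lr_ker (lr_exp S k) :&: lr_root_c S)
       (lr_ker (lr_exp S k.-1) :&: lr_root_c S).

Definition weyrC_nth (K : fieldType) (X : vectType K) (S : linrel X)
    (k : nat) : nat :=
  if k == 1%N then qdim (lr_ran S + lr_dom S) (lr_ran S + lr_root S 0)
  else qdim (lr_ran (lr_exp S k) + lr_root S 0)
            (lr_ran (lr_exp S k.+1) + lr_root S 0).

(* The finite sequence a_1, ..., a_n with its zero entries omitted.  It is used
   with n = dim X: all entries of index k > dim X vanish, see weyrW_nth_eq0,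
   weyrA_nth_eq0, weyrB_nth_eq0 and weyrC_nth_eq0 below. *)
Definition nonzero_entries (n : nat) (a : nat -> nat) : seq nat :=
  [seq c <- [seq a k | k <- iota 1 n] | c != 0%N].

Definition weyrW (K : fieldType) (X : vectType K) (S : linrel X) (l : K) :
    seq nat :=
  nonzero_entries (\dim {:X}) (weyrW_nth S l).
Definition weyrA (K : fieldType) (X : vectType K) (S : linrel X) : seq nat :=
  nonzero_entries (\dim {:X}) (weyrA_nth S).
Definition weyrB (K : fieldType) (X : vectType K) (S : linrel X) : seq nat :=
  nonzero_entries (\dim {:X}) (weyrB_nth S).
Definition weyrC (K : fieldType) (X : vectType K) (S : linrel X) : seq nat :=
  nonzero_entries (\dim {:X}) (weyrC_nth S).

Definition same_weyr (K : fieldType) (X : vectType K) (S1 S2 : linrel X) :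
    Prop :=
  [/\ forall l : K, lr_proper_eigenvalue S1 l = lr_proper_eigenvalue S2 l,
      forall l : K, lr_proper_eigenvalue S1 l -> weyrW S1 l = weyrW S2 l,
      weyrA S1 = weyrA S2,
      weyrB S1 = weyrB S2
    & weyrC S1 = weyrC S2].

Definition strictly_equivalent (K : fieldType) (m : nat)
    (S1 S2 : linrel 'cV[K]_m) : Prop :=
  exists2 T : 'M[K]_m, T \in unitmx &
    forall q : 'cV[K]_m * 'cV[K]_m,
      q \in S2 <-> exists2 p, p \in S1 & q = (T *m p.1, T *m p.2).

Lemma mem_lr_dom (K : fieldType) (X : vectType K) (S : linrel X) (x : X) :
  x \in lr_dom S <-> exists y, (x, y) \in S.
Proof.
split=> [/memv_imgP[[a b] Sab ->]|[y Sxy]].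
  by rewrite lfunE /=; exists b.
by apply/memv_imgP; exists (x, y); rewrite ?lfunE.
Qed.

Lemma mem_lr_ran (K : fieldType) (X : vectType K) (S : linrel X) (y : X) :
  y \in lr_ran S <-> exists x, (x, y) \in S.
Proof.
split=> [/memv_imgP[[a b] Sab ->]|[x Sxy]].
  by rewrite lfunE /=; exists a.
by apply/memv_imgP; exists (x, y); rewrite ?lfunE.
Qed.

Lemma mem_lr_ker (K : fieldType) (X : vectType K) (S : linrel X) (x : X) :
  (x \in lr_ker S) = ((x, 0) \in S).
Proof.
apply/memv_imgP/idP=> [[[a b]]|Sx0].
  by rewrite memv_cap memv_ker !lfunE /= => /andP[Sab /eqP b0] ->; rewrite -b0.
by exists (x, 0); rewrite ?memv_cap ?memv_ker ?lfunE //= Sx0 eqxx.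
Qed.

Lemma mem_lr_mul (K : fieldType) (X : vectType K) (S : linrel X) (y : X) :
  (y \in lr_mul S) = ((0, y) \in S).
Proof.
apply/memv_imgP/idP=> [[[a b]]|S0y].
  by rewrite memv_cap memv_ker !lfunE /= => /andP[Sab /eqP a0] ->; rewrite -a0.
by exists (0, y); rewrite ?memv_cap ?memv_ker ?lfunE //= S0y eqxx.
Qed.

Lemma mem_lr_sub (K : fieldType) (X : vectType K) (S : linrel X) (l : K)
    (x z : X) :
  (x, z) \in lr_sub S l <-> exists2 y, (x, y) \in S & z = y - l *: x.
Proof.
split=> [/memv_imgP[[a b] Sab]|[y Sxy ->]].
  by rewrite lfunE /= => -[-> ->]; exists b.
by apply/memv_imgP; exists (x, y); rewrite ?lfunE.
Qed.

Lemma mem_lr_id (K : fieldType) (X : vectType K) (x y : X) :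
  ((x, y) \in lr_id X) = (x == y).
Proof.
apply/memv_imgP/eqP=> [[a _]|<-]; first by rewrite lfunE /= => -[-> ->].
by exists x; rewrite ?memvf ?lfunE.
Qed.

Lemma mem_lr_comp (K : fieldType) (X : vectType K) (S1 S2 : linrel X)
    (x z : X) :
  (x, z) \in lr_comp S1 S2 <->
  exists2 y, (x, y) \in S2 & (y, z) \in S1.
Proof.
split=> [/memv_imgP[[[a b] c]]|[y Sxy Syz]].
  rewrite memv_cap -!memv_preim !lfunE /= => /andP[Sab Sbc] [-> ->].
  by exists b.
apply/memv_imgP; exists ((x, y), z); last by rewrite lfunE.
by rewrite memv_cap -!memv_preim !lfunE /=; apply/andP.
Qed.

Lemma mem_lr_expSr (K : fieldType) (X : vectType K) (S : linrel X) (k : nat)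
    (x z : X) :
  (x, z) \in lr_exp S k.+1 <->
  exists2 y, (x, y) \in S & (y, z) \in lr_exp S k.
Proof.
elim: k z => [|k IHk] z.
  rewrite mem_lr_comp; split=> -[y].
    by rewrite mem_lr_id => /eqP-> Syz; exists z; rewrite ?mem_lr_id.
  by rewrite mem_lr_id => Sxy /eqP<-; exists x; rewrite ?mem_lr_id.
rewrite [lr_exp S k.+2]/= mem_lr_comp; split=> [[y /IHk[w Sxw Swy] Syz]|].
  by exists w => //; apply/mem_lr_comp; exists y.
case=> w Sxw /mem_lr_comp[y Swy Syz]; exists y => //.
by apply/IHk; exists w.
Qed.

Lemma ascending_stable (K : fieldType) (X : vectType K)
    (U : nat -> {vspace X}) (k : nat) :
  (forall j, U j <= U j.+1)%VS -> (forall j, U j = U j.+1 -> U j.+1 = U j.+2) ->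
  (\dim {:X} <= k)%N -> U k = U (\dim {:X}).
Proof.
move=> incU stabU; set d := \dim {:X}.
have stab_from j i : U j = U j.+1 -> U (j + i)%N = U j /\ U (j + i).+1 = U j.
  move=> Uj; elim: i => [|i [IH1 IH2]]; first by rewrite addn0 -Uj.
  by rewrite addnS IH2; split=> //; rewrite -stabU ?IH1.
have dimU n : (exists2 j, (j < n)%N & U j = U j.+1) \/ (n <= \dim (U n))%N.
  elim: n => [|n [[j ltjn Uj]|leUn]]; [by right | by left; exists j; rewrite // ltnW |].
  case: (eqVneq (U n) (U n.+1)) => [Un|neqU]; first by left; exists n.
  right; apply: leq_ltn_trans leUn _.
  by rewrite (ltn_leqif (dimv_leqif_eq (incU n))).
case: (dimU d.+1) => [[j ltjd Uj] lek|ledU].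
  have lejk : (j <= k)%N by apply: leq_trans lek.
  have [Uk _] := stab_from j (k - j)%N Uj.
  have [Ud _] := stab_from j (d - j)%N Uj.
  by rewrite -(subnKC lejk) -[in RHS](@subnKC j d) // Uk Ud.
by have := leq_trans ledU (dimvS (subvf _)); rewrite ltnn.
Qed.

Lemma descending_stable (K : fieldType) (X : vectType K)
    (U : nat -> {vspace X}) (k : nat) :
  (forall j, U j.+1 <= U j)%VS -> (forall j, U j = U j.+1 -> U j.+1 = U j.+2) ->
  (\dim {:X} <= k)%N -> U k = U (\dim {:X}).
Proof.
move=> decU stabU; set d := \dim {:X}.
have stab_from j i : U j = U j.+1 -> U (j + i)%N = U j /\ U (j + i).+1 = U j.
  move=> Uj; elim: i => [|i [IH1 IH2]]; first by rewrite addn0 -Uj.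
  by rewrite addnS IH2; split=> //; rewrite -stabU ?IH1.
have dimU n : (exists2 j, (j < n)%N & U j = U j.+1) \/ (\dim (U n) + n <= d)%N.
  elim: n => [|n [[j ltjn Uj]|leUn]].
  - by right; rewrite addn0 dimvS ?subvf.
  - by left; exists j; rewrite // ltnW.
  case: (eqVneq (U n) (U n.+1)) => [Un|neqU]; first by left; exists n.
  right; apply: leq_trans leUn; rewrite addnS ltn_add2r.
  by rewrite (ltn_leqif (dimv_leqif_eq (decU n))) eq_sym.
case: (dimU d.+1) => [[j ltjd Uj] lek|ledU].
  have lejk : (j <= k)%N by apply: leq_trans lek.
  have [Uk _] := stab_from j (k - j)%N Uj.
  have [Ud _] := stab_from j (d - j)%N Uj.
  by rewrite -(subnKC lejk) -[in RHS](@subnKC j d) // Uk Ud.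
by have := leq_trans (leq_addl _ _) ledU; rewrite ltnn.
Qed.

Lemma lr_ker_expS (K : fieldType) (X : vectType K) (S : linrel X) (k : nat)
    (x : X) :
  x \in lr_ker (lr_exp S k.+1) <->
  exists2 y, (x, y) \in S & y \in lr_ker (lr_exp S k).
Proof.
rewrite mem_lr_ker mem_lr_expSr.
by split=> -[y Sxy yk]; exists y; rewrite ?mem_lr_ker // -mem_lr_ker.
Qed.

Lemma lr_mul_expS (K : fieldType) (X : vectType K) (S : linrel X) (k : nat)
    (z : X) :
  z \in lr_mul (lr_exp S k.+1) <->
  exists2 y, y \in lr_mul (lr_exp S k) & (y, z) \in S.
Proof.
rewrite mem_lr_mul mem_lr_comp.
by split=> -[y yk Syz]; exists y; rewrite ?mem_lr_mul // -mem_lr_mul.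
Qed.

Lemma lr_ran_expS (K : fieldType) (X : vectType K) (S : linrel X) (k : nat)
    (z : X) :
  z \in lr_ran (lr_exp S k.+1) <->
  exists2 y, y \in lr_ran (lr_exp S k) & (y, z) \in S.
Proof.
rewrite mem_lr_ran; split=> [[x /mem_lr_comp[y xy Syz]]|[y /mem_lr_ran[x xy] Syz]].
  by exists y => //; apply/mem_lr_ran; exists x.
by exists x; apply/mem_lr_comp; exists y.
Qed.

Lemma lr_ker_exp_sub (K : fieldType) (X : vectType K) (S : linrel X) (k : nat) :
  (lr_ker (lr_exp S k) <= lr_ker (lr_exp S k.+1))%VS.
Proof.
apply/subvP=> x; rewrite !mem_lr_ker => Sx0.
by apply/mem_lr_comp; exists 0; rewrite ?mem0v.
Qed.

Lemma lr_mul_exp_sub (K : fieldType) (X : vectType K) (S : linrel X) (k : nat) :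
  (lr_mul (lr_exp S k) <= lr_mul (lr_exp S k.+1))%VS.
Proof.
apply/subvP=> y; rewrite !mem_lr_mul => S0y.
by apply/mem_lr_expSr; exists 0; rewrite ?mem0v.
Qed.

Lemma lr_ran_exp_sub (K : fieldType) (X : vectType K) (S : linrel X) (k : nat) :
  (lr_ran (lr_exp S k.+1) <= lr_ran (lr_exp S k))%VS.
Proof.
apply/subvP=> z /mem_lr_ran[x /mem_lr_expSr[y _ Syz]].
by apply/mem_lr_ran; exists y.
Qed.

Lemma vspace_iffP (K : fieldType) (X : vectType K) (U V : {vspace X}) :
  (forall x, x \in U <-> x \in V) -> U = V.
Proof. by move=> UV; apply/vspaceP=> x; apply/idP/idP=> /UV. Qed.

Lemma lr_ker_exp_stable (K : fieldType) (X : vectType K) (S : linrel X)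
    (k : nat) :
  (\dim {:X} <= k)%N -> lr_ker (lr_exp S k) = lr_ker (lr_exp S (\dim {:X})).
Proof.
apply: (@ascending_stable _ _ (fun k => lr_ker (lr_exp S k))) => [j|j eqj].
  exact: lr_ker_exp_sub.
by apply: vspace_iffP => x; rewrite !(lr_ker_expS S _ x) -eqj.
Qed.

Lemma lr_mul_exp_stable (K : fieldType) (X : vectType K) (S : linrel X)
    (k : nat) :
  (\dim {:X} <= k)%N -> lr_mul (lr_exp S k) = lr_mul (lr_exp S (\dim {:X})).
Proof.
apply: (@ascending_stable _ _ (fun k => lr_mul (lr_exp S k))) => [j|j eqj].
  exact: lr_mul_exp_sub.
by apply: vspace_iffP => x; rewrite !(lr_mul_expS S _ x) -eqj.
Qed.

Lemma lr_ran_exp_stable (K : fieldType) (X : vectType K) (S : linrel X)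
    (k : nat) :
  (\dim {:X} <= k)%N -> lr_ran (lr_exp S k) = lr_ran (lr_exp S (\dim {:X})).
Proof.
apply: (@descending_stable _ _ (fun k => lr_ran (lr_exp S k))) => [j|j eqj].
  exact: lr_ran_exp_sub.
by apply: vspace_iffP => x; rewrite !(lr_ran_expS S _ x) -eqj.
Qed.

Lemma mem_lr_root (K : fieldType) (X : vectType K) (S : linrel X) (l : K)
    (x : X) :
  x \in lr_root S l <-> exists k, x \in lr_ker (lr_exp (lr_sub S l) k).
Proof.
split=> [xR|[k xk]]; first by exists (\dim {:X}).
have mono i : x \in lr_ker (lr_exp (lr_sub S l) (k + i)).
  by elim: i => [|i IH]; rewrite ?addn0 // addnS (subvP (lr_ker_exp_sub _ _)).
rewrite /lr_root -(@lr_ker_exp_stable _ _ _ (k + \dim {:X})) ?leq_addl //.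
Qed.

Lemma mem_lr_root_inf (K : fieldType) (X : vectType K) (S : linrel X) (x : X) :
  x \in lr_root_inf S <-> exists k, x \in lr_mul (lr_exp S k).
Proof.
split=> [xR|[k xk]]; first by exists (\dim {:X}).
have mono i : x \in lr_mul (lr_exp S (k + i)).
  by elim: i => [|i IH]; rewrite ?addn0 // addnS (subvP (lr_mul_exp_sub _ _)).
rewrite /lr_root_inf -(@lr_mul_exp_stable _ _ _ (k + \dim {:X})) ?leq_addl //.
Qed.

Lemma qdimvv (K : fieldType) (X : vectType K) (U : {vspace X}) : qdim U U = 0%N.
Proof. by apply/eqP; rewrite /qdim dimv_eq0 diffv_eq0. Qed.

Lemma weyrW_nth_eq0 (K : fieldType) (X : vectType K) (S : linrel X) (l : K)
    (k : nat) : (\dim {:X} < k)%N -> weyrW_nth S l k = 0%N.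
Proof.
case: k => // k ltdk; rewrite /weyrW_nth /=.
by rewrite -/(lr_exp _ k.+1) !lr_ker_exp_stable ?qdimvv // ltnW.
Qed.

Lemma weyrA_nth_eq0 (K : fieldType) (X : vectType K) (S : linrel X) (k : nat) :
  (\dim {:X} < k)%N -> weyrA_nth S k = 0%N.
Proof.
case: k => // k ltdk; rewrite /weyrA_nth /=.
by rewrite -/(lr_exp _ k.+1) !lr_mul_exp_stable ?qdimvv // ltnW.
Qed.

Lemma weyrB_nth_eq0 (K : fieldType) (X : vectType K) (S : linrel X) (k : nat) :
  (\dim {:X} < k)%N -> weyrB_nth S k = 0%N.
Proof.
case: k => // k ltdk; rewrite /weyrB_nth /=.
by rewrite -/(lr_exp _ k.+1) !lr_ker_exp_stable ?qdimvv // ltnW.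
Qed.

Lemma weyrC_nth_eq0 (K : fieldType) (X : vectType K) (S : linrel X) (k : nat) :
  (\dim {:X} < k)%N -> weyrC_nth S k = 0%N.
Proof.
move=> ltdk; rewrite /weyrC_nth; case: eqP ltdk => [-> ltd1|_ ltdk].
  have trivX (U : {vspace X}) : U = 0%VS.
    apply/eqP; rewrite -dimv_eq0 -leqn0; apply: leq_trans (dimvS (subvf U)) _.
    by rewrite -ltnS.
  by rewrite [X in qdim X _]trivX [X in qdim _ X]trivX qdimvv.
by rewrite !lr_ran_exp_stable ?qdimvv ?(ltnW ltdk) // leqW // ltnW.
Qed.

(* Main.v *)
Require Import Defs.
From HB Require Import structures.
From mathcomp Require Import all_boot all_order all_algebra.
From mathcomp Require Import reals complex.
From mathcomp Require Import zify.
Set Implicit Arguments.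
Unset Strict Implicit.
Unset Printing Implicit Defensive.
Import GRing.Theory.
Local Open Scope ring_scope.

(** An invertible matrix carrying S1 onto S2 carries every subspace that enters
    the definition of the Weyr characteristic of S1 onto the corresponding one
    for S2, so one direction is a transport of structure.

    For the converse no canonical form is needed: an isomorphism is built by
    induction on dim S.  The guiding picture is the Kronecker decomposition of
    S into chains x_1 -> x_2 -> ... of related vectors: Jordan chains at the
    finite eigenvalues (counted by W), chains starting from 0 (A), chains from
    0 to 0 (B), and chains open at both ends (C), the k-th entry of a sequence
    counting the chains whose length is at least some bound growing with k.
    Each induction step shortens some of these chains by one vector, hence
    deletes the first entry of the corresponding sequences and leaves the other
    ones unchanged; the deleted entries are exactly what is needed to lift an
    isomorphism of the shortened relations to one of the original relations.

    - If ran S is not contained in dom S, S is restricted to dom S: the chains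
      of types A and C lose their last vector (weyrA_restr, weyrC_restr, while
      W and B are unchanged), and isomorphisms lift by lr_iso_restr.
    - If ran S <= dom S, there are no chains of types A and C.  As long as
      mul S <> 0, the images of all vectors modulo mul S are taken: the chains
      of type B lose their first vector (weyrB_quot, weyrW_quot), and
      isomorphisms lift by lr_iso_quot.
    - If moreover mul S = 0, S is a linear operator on dom S.  It has an
      eigenvalue l as soon as dom S <> 0, and S is restricted to the range of
      S - l.  This is the first reduction applied to the inverse of S - l,
      since W(S, l) is the sequence A of this inverse (weyrW_invE).

    Two facts make the bookkeeping uniform.  Every shift of a sequence is an
    equality of dimensions of two quotient spaces that S puts in bijection, and
    lr_dim_transfer is that principle.  The four sequences are non-increasing,
    so that dropping their zero entries loses no information
    (nonzero_entries_inj). *)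

(** * Dimensions of subspaces *)
Section Spaces.
Variables (K : fieldType) (X : vectType K).
Implicit Types (U V W : {vspace X}) (x y z : X).

Lemma qdimE U V : (V <= U)%VS -> (qdim U V + \dim V = \dim U)%N.
Proof. by move=> /capv_idPr sVU; rewrite -(dimv_cap_compl U V) sVU addnC. Qed.

Lemma mem_addl U V x : x \in U -> x \in (U + V)%VS.
Proof. exact: (subvP (addvSl U V)). Qed.

Lemma mem_addr U V x : x \in V -> x \in (U + V)%VS.
Proof. exact: (subvP (addvSr U V)). Qed.

Lemma dim_add_modular U V W :
  (V <= U)%VS -> (\dim (U + W) + \dim V <= \dim (V + W) + \dim U)%N.
Proof.
move=> sVU; have sc : (\dim (V :&: W) <= \dim (U :&: W))%N.
  by apply/dimvS/capvS.
have := dimv_sum_cap U W; have := dimv_sum_cap V W; lia.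
Qed.

Lemma lker0_dim (f : 'End(X)) U : lker f == 0%VS -> \dim (f @: U) = \dim U.
Proof. by move=> /eqP f0; rewrite limg_dim_eq // f0 capv0. Qed.

Lemma limg_qdim (f : 'End(X)) U V :
  lker f == 0%VS -> qdim (f @: U) (f @: V) = qdim U V.
Proof.
move=> f0; have := dimv_cap_compl U V.
have := dimv_cap_compl (f @: U) (f @: V).
rewrite -lker0_img_cap // !lker0_dim // /qdim; lia.
Qed.

Lemma iso_eqdim U V : \dim U = \dim V -> exists h : 'End(X), (h @: U = V)%VS.
Proof.
move=> eqd; have [h hP] := linear_of_free (vbasis U) (vbasis V).
exists (linfun h).
rewrite -[in LHS](span_basis (vbasisP U)) limg_span.
rewrite (eq_map (lfunE h)) hP ?(span_basis (vbasisP V)) //.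
  exact: basis_free (vbasisP U).
by rewrite !size_tuple.
Qed.

End Spaces.

(** * Elementary operations on linear relations *)
Section Relations.
Variables (K : fieldType) (X : vectType K).
Implicit Types (S P G : linrel X) (U V W : {vspace X}) (x y z : X).
Implicit Types f g : 'End(X).

Lemma lr_memD S x y x' y' :
  (x, y) \in S -> (x', y') \in S -> (x + x', y + y') \in S.
Proof. exact: memvD. Qed.

Lemma lr_memB S x y x' y' :
  (x, y) \in S -> (x', y') \in S -> (x - x', y - y') \in S.
Proof. exact: memvB. Qed.

Lemma lr_mem_eq S x y y' : (x, y) \in S -> (x, y') \in S -> y - y' \in lr_mul S.
Proof. by move=> Sxy /(lr_memB Sxy); rewrite subrr mem_lr_mul. Qed.

Lemma lr_mem_keq S x x' y : (x, y) \in S -> (x', y) \in S -> x - x' \in lr_ker S.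
Proof. by move=> Sxy /(lr_memB Sxy); rewrite subrr mem_lr_ker. Qed.

Lemma lr_mem_mul S x y m : (x, y) \in S -> m \in lr_mul S -> (x, y + m) \in S.
Proof. by rewrite mem_lr_mul => Sxy /(lr_memD Sxy); rewrite addr0. Qed.

Lemma dim_dom_mul S : (\dim (lr_dom S) + \dim (lr_mul S) = \dim S)%N.
Proof.
rewrite -(limg_ker_dim (linfun fst) S) addnC; congr addn.
rewrite [LHS]limg_dim_eq //; apply/eqP; rewrite -subv0; apply/subvP=> -[a b].
rewrite !memv_cap !memv_ker !lfunE /= memv0.
by move=> /andP[/andP[_ /eqP-> /eqP->]].
Qed.

Lemma dim_ran_ker S : (\dim (lr_ran S) + \dim (lr_ker S) = \dim S)%N.
Proof.
rewrite -(limg_ker_dim (linfun snd) S) addnC; congr addn.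
rewrite [LHS]limg_dim_eq //; apply/eqP; rewrite -subv0; apply/subvP=> -[a b].
rewrite !memv_cap !memv_ker !lfunE /= memv0.
by move=> /andP[/andP[_ /eqP-> /eqP->]].
Qed.

Lemma lr_domP S x y : (x, y) \in S -> x \in lr_dom S.
Proof. by move=> Sxy; apply/mem_lr_dom; exists y. Qed.

Lemma lr_ranP S x y : (x, y) \in S -> y \in lr_ran S.
Proof. by move=> Sxy; apply/mem_lr_ran; exists x. Qed.

Lemma linrel_sub S P : (forall x y, (x, y) \in S -> (x, y) \in P) -> (S <= P)%VS.
Proof. by move=> sSP; apply/subvP=> -[x y]; apply: sSP. Qed.

Lemma linrelP S P : (forall x y, ((x, y) \in S) = ((x, y) \in P)) -> S = P.
Proof. by move=> eqSP; apply/vspaceP=> -[x y]. Qed.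

Definition lr_cut S U V : linrel X :=
  (S :&: linfun fst @^-1: U :&: linfun snd @^-1: V)%VS.

Lemma mem_lr_cut S U V x y :
  ((x, y) \in lr_cut S U V) = [&& (x, y) \in S, x \in U & y \in V].
Proof. by rewrite !memv_cap -!memv_preim !lfunE /= andbA. Qed.

Definition swapv (p : X * X) : X * X := (p.2, p.1).

Fact swapv_is_linear : linear swapv.
Proof. by []. Qed.
HB.instance Definition _ :=
  GRing.isLinear.Build K (X * X)%type (X * X)%type _ swapv swapv_is_linear.

Definition lr_inv S : linrel X := (linfun swapv @: S)%VS.

Lemma mem_lr_inv S x y : ((x, y) \in lr_inv S) = ((y, x) \in S).
Proof.
apply/memv_imgP/idP=> [[[a b] Sab]|Syx].
  by rewrite lfunE /= => -[-> ->].
by exists (y, x); rewrite ?lfunE.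
Qed.

Lemma lr_dom_inv S : lr_dom (lr_inv S) = lr_ran S.
Proof.
apply: vspace_iffP => x; rewrite mem_lr_dom mem_lr_ran.
by split=> -[y Sy]; exists y; rewrite mem_lr_inv in Sy *.
Qed.

Lemma lr_mul_inv S : lr_mul (lr_inv S) = lr_ker S.
Proof. by apply/vspaceP=> x; rewrite mem_lr_mul mem_lr_inv mem_lr_ker. Qed.

Lemma lr_ker_inv S : lr_ker (lr_inv S) = lr_mul S.
Proof. by apply/vspaceP=> x; rewrite mem_lr_mul mem_lr_ker mem_lr_inv. Qed.

Definition lfpair (f g : 'End(X)) (x : X) : X * X := (f x, g x).

Fact lfpair_is_linear f g : linear (lfpair f g).
Proof. by move=> a x y; rewrite /lfpair !linearP. Qed.
HB.instance Definition _ f g :=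
  GRing.isLinear.Build K X (X * X)%type _ (lfpair f g) (lfpair_is_linear f g).

(** For f the identity, this is the graph of the restriction of g to U. *)
Definition lr_pairs (f g : 'End(X)) U : linrel X := (linfun (lfpair f g) @: U)%VS.

Lemma mem_lr_pairs f g U x y :
  (x, y) \in lr_pairs f g U <-> exists2 u, u \in U & (x, y) = (f u, g u).
Proof.
split=> [/memv_imgP[u Uu]|[u Uu ->]]; first by rewrite lfunE; exists u.
by apply/memv_imgP; exists u; rewrite ?lfunE.
Qed.

Definition lfmap2 (f : 'End(X)) (p : X * X) : X * X := (f p.1, f p.2).

Fact lfmap2_is_linear f : linear (lfmap2 f).
Proof. by move=> a x y; rewrite /lfmap2 !linearP. Qed.
HB.instance Definition _ f :=
  GRing.isLinear.Build K (X * X)%type (X * X)%type _ (lfmap2 f)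
    (lfmap2_is_linear f).

Definition lr_map (f : 'End(X)) S : linrel X := (linfun (lfmap2 f) @: S)%VS.

Lemma mem_lr_map f S x y :
  (x, y) \in lr_map f S <->
  exists p, [/\ p \in S, x = f p.1 & y = f p.2].
Proof.
split=> [/memv_imgP[p Sp]|[p [Sp -> ->]]].
  by rewrite lfunE => -[-> ->]; exists p.
by apply/memv_imgP; exists p; rewrite ?lfunE.
Qed.

Lemma lr_map_mem f S x y : (x, y) \in S -> (f x, f y) \in lr_map f S.
Proof. by move=> Sxy; apply/mem_lr_map; exists (x, y). Qed.

Lemma lr_dim_map f S : lker f == 0%VS -> \dim (lr_map f S) = \dim S.
Proof.
move=> /lker0P fI; rewrite limg_dim_eq //; apply/eqP; rewrite -subv0.
apply/subvP=> -[a b]; rewrite memv_cap memv_ker lfunE memv0 => /andP[_].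
by move=> /eqP[]; rewrite -[in f a = _](linear0 f) -[in f b = _](linear0 f)
  => /fI-> /fI->.
Qed.

End Relations.

(** * Linear maps contained in a relation *)
Section Gluing.
Variables (K : fieldType) (X : vectType K).
Implicit Types (S P G : linrel X) (U V W : {vspace X}) (x y z : X).
Implicit Types f g : 'End(X).

Lemma lfun_glue U V (f g : 'End(X)) : (U :&: V = 0)%VS ->
  exists h : 'End(X), {in U, h =1 f} /\ {in V, h =1 g}.
Proof.
move=> UV0; have VU0 : (V :&: U = 0)%VS by rewrite capvC.
have pi0 (A B : {vspace X}) b : (A :&: B = 0)%VS -> b \in B -> daddv_pi A B b = 0.
  move=> AB0 Bb; apply: (addIr b); rewrite add0r.
  by rewrite -[X in _ + X](@daddv_pi_id _ _ B A) 1?capvC // daddv_pi_add ?mem_addr.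
exists ((f \o daddv_pi U V)%VF + (g \o daddv_pi V U)%VF).
split=> x xU; rewrite add_lfunE !comp_lfunE.
  by rewrite (daddv_pi_id UV0 xU) (pi0 _ _ _ VU0 xU) linear0 addr0.
by rewrite (daddv_pi_id VU0 xU) (pi0 _ _ _ UV0 xU) linear0 add0r.
Qed.

(** A partial inverse of the first projection of S onto dom S, followed by the
    second projection. *)
Lemma lr_section S : exists s : 'End(X), forall x, x \in lr_dom S -> (x, s x) \in S.
Proof.
pose g : 'Hom((X * X)%type, X) := (linfun fst \o projv S)%VF.
exists (linfun snd \o projv S \o g^-1)%VF => x /mem_lr_dom[y Sxy].
have gx : x \in limg g.
  apply/memv_imgP; exists (x, y); rewrite ?memvf // comp_lfunE.
  by rewrite projv_id // lfunE.
rewrite -[X in (X, _)](limg_lfunVK gx) !comp_lfunE !lfunE /=.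
by rewrite -surjective_pairing memv_proj.
Qed.

Lemma lfun_ext_inj U (f : 'End(X)) : (forall x, x \in U -> f x = 0 -> x = 0) ->
  exists2 g : 'End(X), lker g == 0%VS & {in U, g =1 f}.
Proof.
move=> fI; have fU0 : (U :&: lker f = 0)%VS.
  apply/eqP; rewrite -subv0; apply/subvP=> x; rewrite memv_cap memv_ker memv0.
  by move=> /andP[Ux /eqP/(fI x Ux)->].
have [k kE] : exists k : 'End(X), (k @: U^C = (f @: U)^C)%VS.
  by apply: iso_eqdim; rewrite !dimv_compl limg_dim_eq.
have [g [gf gk]] := lfun_glue f k (capv_compl U).
exists g; last by [].
have gT : limg g = fullv.
  rewrite -[in LHS](addv_complf U) limgD (eq_in_limg gf) (eq_in_limg gk) kE.
  exact: addv_complf.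
by rewrite -dimv_eq0; have := limg_ker_dim g fullv; rewrite capfv gT; lia.
Qed.

(** The way all isomorphisms are obtained below: a relation G describes which
    images are acceptable.  Equality of the dimensions of the domain and of the
    range means ker G and mul G have the same dimension; a section of G on a
    complement of ker G, glued with an isomorphism from ker G to mul G, is
    injective because a vector sent to 0 lies in ker G. *)
Lemma lr_iso_section G : \dim (lr_dom G) = \dim (lr_ran G) ->
  exists2 g : 'End(X),
    lker g == 0%VS & forall x, x \in lr_dom G -> (x, g x) \in G.
Proof.
move=> eqd; have [h hE] : exists h : 'End(X), (h @: lr_ker G = lr_mul G)%VS.
  by apply: iso_eqdim; have := dim_dom_mul G; have := dim_ran_ker G; lia.
have [s sP] := lr_section G.
have [f [fs fh]] := lfun_glue s h (capv_diff (lr_dom G) (lr_ker G)).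
have kerdom : (lr_ker G <= lr_dom G)%VS.
  by apply/subvP=> x; rewrite mem_lr_ker => /lr_domP.
have domE x : x \in lr_dom G ->
    exists2 e, e \in (lr_dom G :\: lr_ker G)%VS & exists2 k, k \in lr_ker G & x = e + k.
  by rewrite -{1}(addv_diff_cap (lr_dom G) (lr_ker G)) (capv_idPr kerdom)
    => /memv_addP.
have hmul k : k \in lr_ker G -> (0, h k) \in G.
  by move=> kG; rewrite -mem_lr_mul -hE memv_img.
have fG x : x \in lr_dom G -> (x, f x) \in G.
  move=> /domE[e eE [k kK ->]]; rewrite linearD /= fs // fh //.
  have -> : (e + k, s e + h k) = (e, s e) + ((k, 0) + (0, h k)).
    by congr pair; rewrite /= ?addr0 ?add0r.
  rewrite memvD ?memvD -?mem_lr_ker ?hmul ?sP //.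
  exact: (subvP (diffvSl _ _) _ eE).
have [|g g0 gf] := @lfun_ext_inj (lr_dom G) f.
  move=> x xG fx0; have xK : x \in lr_ker G by rewrite mem_lr_ker -fx0 fG.
  have hk0 : (lr_ker G :&: lker h = 0)%VS.
    apply/eqP; rewrite -dimv_eq0; have := limg_ker_dim h (lr_ker G).
    rewrite hE; have := dim_dom_mul G; have := dim_ran_ker G; lia.
  apply/eqP; rewrite -memv0 -hk0 memv_cap xK memv_ker -fh // fx0; exact: eqxx.
by exists g => // x xG; rewrite gf ?fG.
Qed.

End Gluing.

Local Notation kerx S k := (lr_ker (lr_exp S k)).
Local Notation mulx S k := (lr_mul (lr_exp S k)).
Local Notation domx S k := (lr_dom (lr_exp S k)).
Local Notation ranx S k := (lr_ran (lr_exp S k)).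

(** * Comparing quotients through a relation *)
Section Counting.
Variables (K : fieldType) (X : vectType K).
Implicit Types (S P : linrel X) (U V : {vspace X}) (x y z : X).

(** P induces a linear map from U1 / U0 to V1 / V0: the last hypothesis says
    that it is well defined and injective.  The proof counts the dimensions of
    the restrictions of P to U1 x V1 and U0 x V0, which have the same kernel
    and the same multivalued part. *)
Lemma lr_dim_transfer_le P U0 U1 V0 V1 :
  (U0 <= U1)%VS -> (V0 <= V1)%VS ->
  (forall x, x \in U1 -> exists2 y, y \in V1 & (x, y) \in P) ->
  (forall x y, (x, y) \in P -> x \in U1 -> y \in V1 ->
     (x \in U0) = (y \in V0)) ->
  (\dim U1 + \dim V0 <= \dim V1 + \dim U0)%N.
Proof.
move=> sU sV tot sat; pose P1 := lr_cut P U1 V1; pose P0 := lr_cut P U0 V0.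
have dom1 : lr_dom P1 = U1.
  apply: vspace_iffP => x; rewrite mem_lr_dom; split=> [[y]|xU].
    by rewrite mem_lr_cut => /and3P[].
  by have [y yV Pxy] := tot x xU; exists y; rewrite mem_lr_cut Pxy xU.
have dom0 : lr_dom P0 = U0.
  apply: vspace_iffP => x; rewrite mem_lr_dom; split=> [[y]|xU].
    by rewrite mem_lr_cut => /and3P[].
  have xU1 := subvP sU x xU; have [y yV Pxy] := tot x xU1; exists y.
  by rewrite mem_lr_cut Pxy xU -(sat x y).
have mulE : lr_mul P1 = lr_mul P0.
  apply/vspaceP=> y; rewrite !mem_lr_mul !mem_lr_cut !mem0v.
  case P0y: ((0, y) \in P) => //=; apply/idP/idP=> [yV|/(subvP sV)] //.
  by rewrite -(sat 0 y) ?mem0v.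
have kerE : lr_ker P1 = lr_ker P0.
  apply/vspaceP=> x; rewrite !mem_lr_ker !mem_lr_cut !mem0v !andbT.
  case P0x: ((x, 0) \in P) => //=; apply/idP/idP=> [xU|/(subvP sU)] //.
  by rewrite (sat x 0) ?mem0v.
have ranE : lr_ran P0 = (lr_ran P1 :&: V0)%VS.
  apply: vspace_iffP => y; rewrite memv_cap; split=> [/mem_lr_ran[x]|].
    rewrite mem_lr_cut => /and3P[Pxy xU yV]; rewrite yV andbT.
    by apply/mem_lr_ran; exists x; rewrite mem_lr_cut Pxy (subvP sU) ?(subvP sV).
  case/andP=> /mem_lr_ran[x]; rewrite mem_lr_cut => /and3P[Pxy xU yV1] yV.
  by apply/mem_lr_ran; exists x; rewrite mem_lr_cut Pxy (sat x y) // yV.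
have sR : (lr_ran P1 + V0 <= V1)%VS.
  rewrite subv_add sV andbT; apply/subvP=> y /mem_lr_ran[x].
  by rewrite mem_lr_cut => /and3P[].
have := dim_dom_mul P1; have := dim_dom_mul P0.
have := dim_ran_ker P1; have := dim_ran_ker P0.
rewrite dom1 dom0 mulE kerE ranE.
have := dimv_sum_cap (lr_ran P1) V0; have := dimvS sR; lia.
Qed.

Lemma lr_dim_transfer P U0 U1 V0 V1 :
  (U0 <= U1)%VS -> (V0 <= V1)%VS ->
  (forall x, x \in U1 -> exists2 y, y \in V1 & (x, y) \in P) ->
  (forall y, y \in V1 -> exists2 x, x \in U1 & (x, y) \in P) ->
  (forall x y, (x, y) \in P -> x \in U1 -> y \in V1 ->
     (x \in U0) = (y \in V0)) ->
  (\dim U1 + \dim V0 = \dim V1 + \dim U0)%N.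
Proof.
move=> sU sV tot sur sat; apply/eqP; rewrite eqn_leq.
rewrite (lr_dim_transfer_le sU sV tot sat) /=.
apply: (@lr_dim_transfer_le (lr_inv P)) => // [y /sur[x xU Pxy]|y x].
  by exists x; rewrite ?mem_lr_inv.
by rewrite mem_lr_inv => Pxy yV xU; rewrite (sat x y).
Qed.

End Counting.

(** * Powers and root spaces *)
Section Powers.
Variables (K : fieldType) (X : vectType K).
Implicit Types (S : linrel X) (U V : {vspace X}) (x y z : X) (k : nat).

Lemma lr_sub0 S : lr_sub S 0 = S.
Proof.
apply: vspace_iffP => -[x z]; rewrite mem_lr_sub scale0r.
by split=> [[y Sxy ->]|Sxz]; [rewrite subr0 | exists z; rewrite ?subr0].
Qed.

Lemma lr_exp1 S : lr_exp S 1 = S.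
Proof.
apply: vspace_iffP => -[x z]; rewrite mem_lr_comp; split=> [[y]|Sxz].
  by rewrite mem_lr_id => /eqP->.
by exists x; rewrite ?mem_lr_id.
Qed.

Lemma lr_ker_exp0 S : kerx S 0 = 0%VS.
Proof. by apply/vspaceP=> x; rewrite mem_lr_ker mem_lr_id memv0. Qed.

Lemma lr_mul_exp0 S : mulx S 0 = 0%VS.
Proof. by apply/vspaceP=> x; rewrite mem_lr_mul mem_lr_id memv0 eq_sym. Qed.

Lemma lr_dom_expS S k x :
  x \in domx S k.+1 <-> exists2 y, (x, y) \in S & y \in domx S k.
Proof.
rewrite mem_lr_dom; split=> [[z /mem_lr_expSr[y Sxy yz]]|[y Sxy /mem_lr_dom[z yz]]].
  by exists y => //; apply/mem_lr_dom; exists z.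
by exists z; apply/mem_lr_expSr; exists y.
Qed.

Lemma lr_dom_exp_sub S k : (domx S k.+1 <= domx S k)%VS.
Proof.
apply/subvP=> x /mem_lr_dom[z /mem_lr_comp[y Sxy _]].
by apply/mem_lr_dom; exists y.
Qed.

Lemma lr_dom_exp_dom S k : (domx S k.+1 <= lr_dom S)%VS.
Proof.
rewrite -{2}(lr_exp1 S); elim: k => // k; apply: subv_trans.
exact: lr_dom_exp_sub.
Qed.

Lemma lr_mul_sub_exp S k : (lr_mul S <= mulx S k.+1)%VS.
Proof.
rewrite -{1}(lr_exp1 S); elim: k => // k /subv_trans; apply.
exact: lr_mul_exp_sub.
Qed.

Lemma lr_rootE S : lr_root S 0 = kerx S (\dim {:X}).
Proof. by rewrite /lr_root lr_sub0. Qed.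

Lemma lr_ker_exp_root S k : (kerx S k <= lr_root S 0)%VS.
Proof. by apply/subvP=> x xk; apply/mem_lr_root; exists k; rewrite lr_sub0. Qed.

Lemma lr_mul_exp_root S k : (mulx S k <= lr_root_inf S)%VS.
Proof. by apply/subvP=> x xk; apply/mem_lr_root_inf; exists k. Qed.

Lemma lr_rootP S x :
  x \in lr_root S 0 <-> exists2 y, (x, y) \in S & y \in lr_root S 0.
Proof.
rewrite lr_rootE -{1}(@lr_ker_exp_stable _ _ S _ (leqnSn _)).
exact: lr_ker_expS.
Qed.

Lemma lr_root_infP S y :
  y \in lr_root_inf S <-> exists2 x, x \in lr_root_inf S & (x, y) \in S.
Proof.
rewrite /lr_root_inf -{1}(@lr_mul_exp_stable _ _ S _ (leqnSn _)).
exact: lr_mul_expS.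
Qed.

Lemma lr_root_pred S x y : (x, y) \in S -> y \in lr_root S 0 -> x \in lr_root S 0.
Proof. by move=> Sxy yR; apply/lr_rootP; exists y. Qed.

Lemma lr_root_inf_succ S x y :
  (x, y) \in S -> x \in lr_root_inf S -> y \in lr_root_inf S.
Proof. by move=> Sxy xR; apply/lr_root_infP; exists x. Qed.

Lemma lr_ker_root S : (lr_ker S <= lr_root S 0)%VS.
Proof. by rewrite -{1}(lr_exp1 S) lr_ker_exp_root. Qed.

Lemma lr_mul_root S : (lr_mul S <= lr_root_inf S)%VS.
Proof. by rewrite -{1}(lr_exp1 S) lr_mul_exp_root. Qed.

Lemma lr_root_dom S : (lr_root S 0 <= lr_dom S)%VS.
Proof. by apply/subvP=> x /lr_rootP[y Sxy _]; apply: lr_domP Sxy. Qed.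

Lemma lr_root_c_root S : (lr_root_c S <= lr_root S 0)%VS.
Proof. exact: capvSl. Qed.

Lemma lr_root_c_inf S : (lr_root_c S <= lr_root_inf S)%VS.
Proof. exact: capvSr. Qed.

Lemma lr_root_c_dom S : (lr_root_c S <= lr_dom S)%VS.
Proof. exact: subv_trans (lr_root_c_root S) (lr_root_dom S). Qed.

Lemma lr_root_c_succ S x :
  x \in lr_root_c S -> exists2 y, y \in lr_root_c S & (x, y) \in S.
Proof.
rewrite memv_cap => /andP[/lr_rootP[y Sxy yR] xR]; exists y => //.
by rewrite memv_cap yR (lr_root_inf_succ Sxy).
Qed.

Lemma lr_root_c_pred S y :
  y \in lr_root_c S -> exists2 x, x \in lr_root_c S & (x, y) \in S.
Proof.
rewrite memv_cap => /andP[yR /lr_root_infP[x xR Sxy]]; exists x => //.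
by rewrite memv_cap xR (lr_root_pred Sxy).
Qed.

Lemma lr_root_pred_exp S k x y :
  (x, y) \in lr_exp S k -> y \in lr_root S 0 -> x \in lr_root S 0.
Proof.
elim: k x => [|k IH] x; first by rewrite mem_lr_id => /eqP->.
by move=> /mem_lr_expSr[z Sxz Szy] /(IH z Szy); apply: lr_root_pred.
Qed.

Lemma lr_root_succ_exp S k x : x \in lr_root S 0 ->
  exists2 y, y \in lr_root S 0 & (x, y) \in lr_exp S k.
Proof.
elim: k => [|k IH] xR; first by exists x; rewrite ?mem_lr_id.
have [y yR Sxy] := IH xR; have /lr_rootP[z Syz zR] := yR.
by exists z => //; apply/mem_lr_comp; exists y.
Qed.

Lemma lr_root_dom_exp S k : (lr_root S 0 <= domx S k)%VS.
Proof.
by apply/subvP=> x /(lr_root_succ_exp k)[y _ Sxy]; apply: lr_domP Sxy.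
Qed.

Lemma lr_dom_cut_root_c S :
  lr_dom (lr_cut S (lr_root_c S) (lr_root_c S)) = lr_root_c S.
Proof.
apply: vspace_iffP => x; rewrite mem_lr_dom; split=> [[y]|xR].
  by rewrite mem_lr_cut => /and3P[].
by have [y yR Sxy] := lr_root_c_succ xR; exists y; rewrite mem_lr_cut Sxy xR.
Qed.

(** The restriction of S to the root space R_c has domain and range equal to
    R_c, and the dimension of a relation is both dim dom + dim mul and
    dim ran + dim ker. *)
Lemma lr_dim_ker_root_c S :
  \dim (lr_ker S :&: lr_root_c S) = \dim (lr_mul S :&: lr_root_c S).
Proof.
pose P := lr_cut S (lr_root_c S) (lr_root_c S).
have domE : lr_dom P = lr_root_c S := lr_dom_cut_root_c S.
have ranE : lr_ran P = lr_root_c S.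
  apply: vspace_iffP => y; rewrite mem_lr_ran; split=> [[x]|yR].
    by rewrite mem_lr_cut => /and3P[].
  by have [x xR Sxy] := lr_root_c_pred yR; exists x; rewrite mem_lr_cut Sxy xR.
have kerE : lr_ker P = (lr_ker S :&: lr_root_c S)%VS.
  by apply/vspaceP=> x; rewrite mem_lr_ker mem_lr_cut memv_cap mem_lr_ker mem0v andbT.
have mulE : lr_mul P = (lr_mul S :&: lr_root_c S)%VS.
  by apply/vspaceP=> x; rewrite mem_lr_mul mem_lr_cut memv_cap mem_lr_mul mem0v.
have := dim_dom_mul P; have := dim_ran_ker P; rewrite domE ranE kerE mulE; lia.
Qed.

End Powers.

(** * The entries as differences of dimensions *)
Section Entries.
Variables (K : fieldType) (X : vectType K).
Implicit Types (S : linrel X) (l : K) (x y z : X) (k : nat).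

Lemma weyrW_dim S l k :
  (weyrW_nth S l k.+1 + \dim (kerx (lr_sub S l) k + lr_root_c S)
   = \dim (kerx (lr_sub S l) k.+1 + lr_root_c S))%N.
Proof. by rewrite qdimE // addvS ?lr_ker_exp_sub. Qed.

Lemma weyrA_dim S k :
  (weyrA_nth S k.+1 + \dim (mulx S k + lr_root_c S)
   = \dim (mulx S k.+1 + lr_root_c S))%N.
Proof. by rewrite qdimE // addvS ?lr_mul_exp_sub. Qed.

Lemma weyrB_dim S k :
  (weyrB_nth S k.+1 + \dim (kerx S k :&: lr_root_c S)
   = \dim (kerx S k.+1 :&: lr_root_c S))%N.
Proof. by rewrite qdimE // capvS ?lr_ker_exp_sub. Qed.

(** The quotient defining C_k is carried by S^k to
    (dom S^k + R(S)) / (R_0(S) + R(S)): if S^k relates x to z, then z is in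
    R(S^(k+1)) + R_0(S) exactly when x is in R(S) + R_0(S).  In this form the
    separate definition of C_1 is no longer an exception. *)
Lemma weyrC_dim S k :
  (weyrC_nth S k.+1 + \dim (lr_root S 0 + lr_ran S)
   = \dim (domx S k.+1 + lr_ran S))%N.
Proof.
case: k => [|k].
  rewrite lr_exp1 /weyrC_nth eqxx !(addvC (lr_ran S)) qdimE //.
  by rewrite addvS ?lr_root_dom.
set n := k.+2; rewrite /weyrC_nth /=.
pose U := domx S n; pose V := ranx S n.
pose A := (lr_root S 0 + lr_ran S)%VS; pose B := (ranx S n.+1 + lr_root S 0)%VS.
have eqd : (\dim U + \dim (V :&: B) = \dim V + \dim (U :&: A))%N.
  apply: (@lr_dim_transfer _ _ (lr_exp S n)); rewrite ?capvSl //.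
  - by move=> x /mem_lr_dom[y Sxy]; exists y => //; apply: lr_ranP Sxy.
  - by move=> y /mem_lr_ran[x Sxy]; exists x => //; apply: lr_domP Sxy.
  move=> x z Sxz xU zV; rewrite !memv_cap xU zV /=; apply/idP/idP.
    case/memv_addP=> r rR [w /mem_lr_ran[v Svw] xE].
    have [r' r'R Srr'] := lr_root_succ_exp n rR.
    rewrite -[z](subrK r') memv_add //; apply/mem_lr_ran; exists v.
    apply/mem_lr_expSr; exists w => //.
    by rewrite -[w](addKr r) -xE addrC; apply: lr_memB.
  case/memv_addP=> w /mem_lr_ran[v /mem_lr_expSr[w' Svw' Sw'w]] [r rR zE].
  rewrite -[x](subrK w') memv_add ?(lr_ranP Svw') //.
  apply: lr_root_pred_exp (lr_memB Sxz Sw'w) _.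
  by rewrite zE addrC addKr.
have UA : (U + A = U + lr_ran S)%VS.
  by rewrite addvA (addv_idPl (lr_root_dom_exp S n)).
have VB : (V + B = V + lr_root S 0)%VS.
  by rewrite addvA (addv_idPl (lr_ran_exp_sub S n)).
have := dimv_sum_cap U A; have := dimv_sum_cap V B; rewrite UA VB.
have : (B <= V + lr_root S 0)%VS by rewrite -VB addvSr.
move/qdimE; rewrite -/n -/V -/B -/A -/U; lia.
Qed.

End Entries.

(** * First entries of A, B and C *)
Section LowEntries.
Variables (K : fieldType) (X : vectType K).
Implicit Types (S : linrel X) (l : K) (x y z : X) (k : nat).

Lemma lr_mul_root_c S : (lr_mul S :&: lr_root S 0 = lr_mul S :&: lr_root_c S)%VS.
Proof.
apply/vspaceP=> x; rewrite !memv_cap; case xM: (x \in lr_mul S) => //=.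
by rewrite (subvP (lr_mul_root S)) ?andbT.
Qed.

(** The last vectors of the chains of types A and C are independent modulo
    dom S.  (A chain of type C with a single vector lies outside
    dom S + ran S, and C_1 only counts the longer ones.)  The proof compares the dimension of S with that of
    its restriction to R_0, whose domain is R_0. *)
Lemma dim_dom_add_ran S :
  \dim (lr_dom S + lr_ran S) = (\dim (lr_dom S) + weyrA_nth S 1 + weyrC_nth S 1)%N.
Proof.
pose P := lr_cut S (lr_root S 0) (lr_root S 0).
have domE : lr_dom P = lr_root S 0.
  apply: vspace_iffP => x; rewrite mem_lr_dom; split=> [[y]|xR].
    by rewrite mem_lr_cut => /and3P[].
  have /lr_rootP[y Sxy yR] := xR.
  by exists y; rewrite mem_lr_cut Sxy xR.
have ranE : lr_ran P = (lr_root S 0 :&: lr_ran S)%VS.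
  apply: vspace_iffP => y; rewrite memv_cap mem_lr_ran; split=> [[x]|].
    by rewrite mem_lr_cut => /and3P[/lr_ranP-> _ ->].
  case/andP=> yR /mem_lr_ran[x Sxy]; exists x.
  by rewrite mem_lr_cut Sxy yR (lr_root_pred Sxy).
have kerE : lr_ker P = lr_ker S.
  apply/vspaceP=> x; rewrite !mem_lr_ker mem_lr_cut mem0v andbT.
  by rewrite -mem_lr_ker; apply/andb_idr/subvP/lr_ker_root.
have mulE : lr_mul P = (lr_mul S :&: lr_root_c S)%VS.
  rewrite -lr_mul_root_c.
  by apply/vspaceP=> x; rewrite mem_lr_mul mem_lr_cut memv_cap mem_lr_mul mem0v.
have := dim_dom_mul P; have := dim_ran_ker P; rewrite domE ranE kerE mulE.
have := dim_dom_mul S; have := dim_ran_ker S.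
have := weyrA_dim S 0; rewrite lr_mul_exp0 add0v lr_exp1.
have := weyrC_dim S 0; rewrite lr_exp1.
have := dimv_sum_cap (lr_root S 0) (lr_ran S).
have := dimv_sum_cap (lr_mul S) (lr_root_c S).
lia.
Qed.

(** Chains from 0 to 0 may be counted by their last vectors, which span the
    space in the definition of B_1, or by their first vectors. *)
Lemma weyrB1 S : weyrB_nth S 1 = \dim (lr_mul S :&: lr_root_c S).
Proof.
have := weyrB_dim S 0.
by rewrite lr_ker_exp0 cap0v dimv0 addn0 lr_exp1 lr_dim_ker_root_c.
Qed.

Lemma weyrA1_eq0 S : weyrA_nth S 1 = 0%N -> (lr_mul S <= lr_root_c S)%VS.
Proof.
move=> A0; have := weyrA_dim S 0; rewrite A0 lr_mul_exp0 lr_exp1 add0v add0n => dE.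
have : (lr_root_c S == lr_mul S + lr_root_c S)%VS by rewrite eqEdim addvSr dE /=.
by move=> /eqP->; rewrite addvSl.
Qed.

Lemma ran_sub_dom S :
  (lr_ran S <= lr_dom S)%VS = (weyrA_nth S 1 + weyrC_nth S 1 == 0)%N.
Proof.
rewrite -(eqn_add2l (\dim (lr_dom S))) addnA -dim_dom_add_ran addn0 eq_sym.
rewrite (dimv_leqif_eq (addvSl (lr_dom S) (lr_ran S))).
by apply/idP/eqP=> [/addv_idPl->|->] //; apply: addvSr.
Qed.

(** In the absence of chains of type A, mul S lies in R_c, hence in R_0; the
    successors of a vector of R_0 are congruent modulo mul S to one in R_0. *)
Lemma lr_root_inf_sub S :
  (lr_ran S <= lr_dom S)%VS -> (lr_root_inf S <= lr_root S 0)%VS.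
Proof.
rewrite ran_sub_dom addn_eq0 => /andP[/eqP/weyrA1_eq0 sM _].
apply/subvP=> x /mem_lr_root_inf[k]; elim: k x => [|k IH] x.
  by rewrite lr_mul_exp0 memv0 => /eqP->; rewrite mem0v.
case/lr_mul_expS=> y /IH/lr_rootP[y' Syy' y'R] Syx.
rewrite -[x](subrK y') memvD //.
exact: subvP (lr_root_c_root S) _ (subvP sM _ (lr_mem_eq Syx Syy')).
Qed.

End LowEntries.

(** * Restriction to the domain *)
Section Restriction.
Variables (K : fieldType) (X : vectType K).
Implicit Types (S : linrel X) (l : K) (x y z : X) (k : nat).

Definition lr_restr S : linrel X := lr_cut S (lr_dom S) (lr_dom S).

Lemma mem_lr_restr S x y :
  ((x, y) \in lr_restr S) = ((x, y) \in S) && (y \in lr_dom S).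
Proof. by rewrite mem_lr_cut; case Sxy: (_ \in S) => //=; rewrite (lr_domP Sxy). Qed.

Lemma lr_dom_sub S l : lr_dom (lr_sub S l) = lr_dom S.
Proof.
apply: vspace_iffP => x; rewrite !mem_lr_dom; split=> -[y].
  by case/mem_lr_sub=> w Sxw _; exists w.
by move=> Sxy; exists (y - l *: x); apply/mem_lr_sub; exists y.
Qed.

Lemma lr_ker_exp_dom S k : (kerx S k <= lr_dom S)%VS.
Proof. exact: subv_trans (lr_ker_exp_root S k) (lr_root_dom S). Qed.

(** A chain that ends in 0 stays in the domain, since each of its vectors has a
    successor. *)
Lemma lr_ker_exp_sub_restr S l k :
  kerx (lr_sub (lr_restr S) l) k = kerx (lr_sub S l) k.
Proof.
elim: k => [|k IH]; first by rewrite !lr_ker_exp0.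
apply: vspace_iffP => x; rewrite !lr_ker_expS IH; split=> -[y].
  case/mem_lr_sub=> w; rewrite mem_lr_restr => /andP[Sxw _] yE yk.
  by exists y => //; apply/mem_lr_sub; exists w.
case/mem_lr_sub=> w Sxw yE yk; exists y => //; apply/mem_lr_sub; exists w => //.
rewrite mem_lr_restr Sxw -[w](subrK (l *: x)) memvD ?memvZ ?(lr_domP Sxw) //.
by rewrite -yE -(lr_dom_sub S l) (subvP (lr_ker_exp_dom _ k)).
Qed.

Lemma lr_ker_exp_restr S k : kerx (lr_restr S) k = kerx S k.
Proof. by have := lr_ker_exp_sub_restr S 0 k; rewrite !lr_sub0. Qed.

Lemma lr_mul_exp_restr S k : mulx (lr_restr S) k = (mulx S k :&: lr_dom S)%VS.
Proof.
elim: k => [|k IH]; first by rewrite !lr_mul_exp0 cap0v.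
apply: vspace_iffP => z; rewrite memv_cap lr_mul_expS; split=> [[y]|].
  rewrite IH memv_cap mem_lr_restr => /andP[yk _] /andP[Syz ->]; rewrite andbT.
  by apply/lr_mul_expS; exists y.
case/andP=> /lr_mul_expS[y yk Syz] zD; exists y; last by rewrite mem_lr_restr Syz.
by rewrite IH memv_cap yk (lr_domP Syz).
Qed.

Lemma lr_mul_restr S : lr_mul (lr_restr S) = (lr_mul S :&: lr_dom S)%VS.
Proof. by have := lr_mul_exp_restr S 1; rewrite !lr_exp1. Qed.

Lemma lr_dom_exp_restr S k : domx (lr_restr S) k.+1 = domx S k.+2.
Proof.
elim: k => [|k IH].
  rewrite lr_exp1; apply: vspace_iffP => x; rewrite mem_lr_dom lr_dom_expS lr_exp1.
  split=> -[y]; first by rewrite mem_lr_restr => /andP[]; exists y.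
  by move=> Sxy yD; exists y; rewrite // mem_lr_restr Sxy.
apply: vspace_iffP => x; rewrite lr_dom_expS IH [X in _ <-> X]lr_dom_expS.
split=> -[y]; first by rewrite mem_lr_restr => /andP[]; exists y.
move=> Sxy yk; exists y; rewrite // mem_lr_restr Sxy.
exact: subvP (lr_dom_exp_dom S k.+1) _ yk.
Qed.

Lemma lr_ran_restr S : lr_ran (lr_restr S) = (lr_ran S :&: lr_dom S)%VS.
Proof.
apply: vspace_iffP => y; rewrite memv_cap mem_lr_ran; split=> [[x]|].
  by rewrite mem_lr_restr => /andP[/lr_ranP-> ->].
by case/andP=> /mem_lr_ran[x Sxy] yD; exists x; rewrite mem_lr_restr Sxy.
Qed.

Lemma lr_root_restr S : lr_root (lr_restr S) 0 = lr_root S 0.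
Proof. by rewrite !lr_rootE lr_ker_exp_restr. Qed.

Lemma lr_root_c_restr S : lr_root_c (lr_restr S) = lr_root_c S.
Proof.
rewrite /lr_root_c lr_root_restr /lr_root_inf lr_mul_exp_restr.
rewrite (capvC (mulx _ _)) capvA; congr capv.
by apply/capv_idPl/lr_root_dom.
Qed.

Lemma weyrW_restr S l k : weyrW_nth (lr_restr S) l k = weyrW_nth S l k.
Proof. by rewrite /weyrW_nth !lr_ker_exp_sub_restr lr_root_c_restr. Qed.

Lemma weyrB_restr S k : weyrB_nth (lr_restr S) k = weyrB_nth S k.
Proof. by rewrite /weyrB_nth !lr_ker_exp_restr lr_root_c_restr. Qed.

Lemma lr_ker_root_c S x : x \in lr_ker S -> x \in lr_root_inf S -> x \in lr_root_c S.
Proof. by move=> /(subvP (lr_ker_root S)) xR xI; rewrite memv_cap xR. Qed.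

(** S itself maps the quotient defining the entry of the restriction onto the
    one defining the entry of S: a vector of R_c has a successor and a
    predecessor in R_c, and an element of ker S in R_inf is in R_c. *)
Lemma weyrA_restr S k : weyrA_nth (lr_restr S) k.+1 = weyrA_nth S k.+2.
Proof.
have := weyrA_dim S k.+1; have := weyrA_dim (lr_restr S) k.
rewrite !lr_mul_exp_restr lr_root_c_restr.
set U1 := (mulx S k.+1 :&: _ + _)%VS; set U0 := (mulx S k :&: _ + _)%VS.
set V1 := (mulx S k.+2 + _)%VS; set V0 := (mulx S k.+1 + _)%VS.
have stepU j x : x \in (mulx S j :&: lr_dom S + lr_root_c S)%VS ->
    exists2 y, y \in (mulx S j.+1 + lr_root_c S)%VS & (x, y) \in S.
  case/memv_addP=> u; rewrite memv_cap => /andP[uj /mem_lr_dom[y Suy]].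
  case=> r /lr_root_c_succ[r' r'R Srr'] ->; exists (y + r'); last exact: lr_memD.
  by rewrite memv_add //; apply/lr_mul_expS; exists u.
have stepV j y : y \in (mulx S j.+1 + lr_root_c S)%VS ->
    exists2 x, x \in (mulx S j :&: lr_dom S + lr_root_c S)%VS & (x, y) \in S.
  case/memv_addP=> z /lr_mul_expS[u uj Suz] [r /lr_root_c_pred[r' r'R Sr'r] ->].
  exists (u + r'); last exact: lr_memD.
  by rewrite memv_add // memv_cap uj (lr_domP Suz).
have infU j x : x \in (mulx S j :&: lr_dom S + lr_root_c S)%VS -> x \in lr_root_inf S.
  case/memv_addP=> u; rewrite memv_cap => /andP[uj _] [r rR ->].
  apply: memvD; first exact: subvP (lr_mul_exp_root S j) _ uj.
  exact: subvP (lr_root_c_inf S) _ rR.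
suff : (\dim U1 + \dim V0 = \dim V1 + \dim U0)%N by lia.
apply: (@lr_dim_transfer _ _ S) => [| | | |x y Sxy xU yV].
- by rewrite addvS // capvS // lr_mul_exp_sub.
- by rewrite addvS // lr_mul_exp_sub.
- exact: stepU.
- exact: stepV.
apply/idP/idP=> [/stepU[y' y'V Sxy']|/stepV[x' x'U Sx'y]].
  rewrite -[y](subrK y') memvD // mem_addl //.
  exact: subvP (lr_mul_sub_exp S k) _ (lr_mem_eq Sxy Sxy').
rewrite -[x](subrK x') memvD // mem_addr // lr_ker_root_c //.
  exact: lr_mem_keq Sxy Sx'y.
by rewrite memvB ?(infU _ _ xU) ?(infU _ _ x'U).
Qed.

(** With C_k written as the quotient of dom S^k + R(S) by R_0(S) + R(S), the
    restriction replaces dom S^k by dom S^(k+1) and R(S) by its intersection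
    with dom S, which contains both dom S^(k+1) and R_0(S); so only the shift
    of the index remains. *)
Lemma weyrC_restr S k : weyrC_nth (lr_restr S) k.+1 = weyrC_nth S k.+2.
Proof.
have := weyrC_dim S k.+1; have := weyrC_dim (lr_restr S) k.
rewrite lr_root_restr lr_ran_restr lr_dom_exp_restr.
have capE (V : {vspace X}) : (V <= lr_dom S)%VS ->
    (V :&: (lr_ran S :&: lr_dom S) = V :&: lr_ran S)%VS.
  by move=> sV; rewrite (capvC (lr_ran S)) capvA (capv_idPl sV).
have sD := lr_dom_exp_dom S k.+1.
have := dimv_sum_cap (domx S k.+2) (lr_ran S).
have := dimv_sum_cap (domx S k.+2) (lr_ran S :&: lr_dom S).
have := dimv_sum_cap (lr_root S 0) (lr_ran S).
have := dimv_sum_cap (lr_root S 0) (lr_ran S :&: lr_dom S).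
rewrite !capE ?lr_root_dom //; lia.
Qed.

(** A_1 - A_2 is the number of chains of type A of length one, which
    disappear in the restriction. *)
Lemma dim_mul_restr S :
  (\dim (lr_mul S) + weyrA_nth S 2 = \dim (lr_mul (lr_restr S)) + weyrA_nth S 1)%N.
Proof.
have := weyrA_dim (lr_restr S) 0; have := weyrA_dim S 0.
rewrite weyrA_restr lr_root_c_restr !lr_mul_exp0 !add0v !lr_exp1 lr_mul_restr.
have := dimv_sum_cap (lr_mul S :&: lr_dom S) (lr_root_c S).
have := dimv_sum_cap (lr_mul S) (lr_root_c S).
rewrite -capvA (capv_idPr (lr_root_c_dom S)); lia.
Qed.

Lemma dim_dom_restr S :
  \dim (lr_dom S) = (\dim (lr_dom (lr_restr S)) + weyrA_nth S 2 + weyrC_nth S 1)%N.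
Proof.
have := dim_dom_mul S; have := dim_ran_ker S; have := dim_dom_add_ran S.
have := dim_mul_restr S; have := dimv_sum_cap (lr_dom S) (lr_ran S).
have := dim_dom_mul (lr_restr S); have := dim_ran_ker (lr_restr S).
rewrite lr_ran_restr capvC.
have -> : lr_ker (lr_restr S) = lr_ker S.
  by have := lr_ker_exp_restr S 1; rewrite !lr_exp1.
lia.
Qed.

End Restriction.

(** * Translation by a scalar and inversion *)
Section Shift.
Variables (K : fieldType) (X : vectType K).
Implicit Types (S P : linrel X) (l : K) (x y z : X) (k : nat).

Lemma lr_sub_subr S l : lr_sub (lr_sub S l) (- l) = S.
Proof.
apply: vspace_iffP => -[x z]; rewrite mem_lr_sub; split=> [[y]|Sxz].
  by case/mem_lr_sub=> w Sxw -> ->; rewrite scaleNr opprK subrK.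
exists (z - l *: x); last by rewrite scaleNr opprK subrK.
by apply/mem_lr_sub; exists z.
Qed.

Lemma lr_mul_exp_subr_le S l k : (mulx (lr_sub S l) k <= mulx S k)%VS.
Proof.
elim: k => [|k IH]; first by rewrite !lr_mul_exp0.
apply/subvP=> z /lr_mul_expS[y /(subvP IH) yk /mem_lr_sub[w Syw ->]].
apply: memvB; first by apply/lr_mul_expS; exists y.
by apply/memvZ; apply: subvP (lr_mul_exp_sub S k) _ yk.
Qed.

Lemma lr_mul_exp_subr S l k : mulx (lr_sub S l) k = mulx S k.
Proof.
apply/eqP; rewrite eqEsubv lr_mul_exp_subr_le /=.
by rewrite -{1}(lr_sub_subr S l) lr_mul_exp_subr_le.
Qed.

Lemma lr_root_inf_subr S l : lr_root_inf (lr_sub S l) = lr_root_inf S.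
Proof. exact: lr_mul_exp_subr. Qed.

Lemma lr_rootS S P : (S <= P)%VS -> (lr_root S 0 <= lr_root P 0)%VS.
Proof.
move=> sSP; rewrite !lr_rootE; elim: (\dim _) => [|k IH].
  by rewrite !lr_ker_exp0.
apply/subvP=> x /lr_ker_expS[y Sxy yk]; apply/lr_ker_expS.
by exists y; [apply: (subvP sSP) | apply: (subvP IH)].
Qed.

Lemma lr_subS S P l : (S <= P)%VS -> (lr_sub S l <= lr_sub P l)%VS.
Proof. exact: limgS. Qed.

(** A chain from 0 to 0 for S does not give explicitly one for S - l.  Instead,
    let P be the restriction of S to R_c(S).  The spaces mul(P^k) exhaust
    R_c(S) and do not change under translation, while dom (P - l) = R_c(S)
    contains ran (P - l); by lr_root_inf_sub this forces
    R_c(S) = R_inf(P - l) <= R_0(P - l). *)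
Lemma lr_root_c_subr_le S l : (lr_root_c S <= lr_root_c (lr_sub S l))%VS.
Proof.
set V := lr_root_c S; pose P := lr_cut S V V.
have sPS : (P <= S)%VS by apply: linrel_sub => x y; rewrite mem_lr_cut => /and3P[].
have domP : lr_dom P = V := lr_dom_cut_root_c S.
have ranP : (lr_ran (lr_sub P l) <= lr_dom (lr_sub P l))%VS.
  rewrite lr_dom_sub domP; apply/subvP=> y /mem_lr_ran[x /mem_lr_sub[w]].
  by rewrite mem_lr_cut => /and3P[_ xV wV] ->; rewrite memvB ?memvZ.
have VinfP : (V <= lr_root_inf P)%VS.
  apply/subvP=> x xV; apply/mem_lr_root_inf.
  have /mem_lr_root_inf[k xk] := subvP (lr_root_c_inf S) x xV.
  exists k; elim: k x xV xk => [|k IH] x xV; first by rewrite !lr_mul_exp0.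
  case/lr_mul_expS=> y yk Syx; have yV : y \in V.
    rewrite memv_cap (lr_root_pred Syx) ?(subvP (lr_root_c_root S)) //=.
    exact: subvP (lr_mul_exp_root S k) _ yk.
  by apply/lr_mul_expS; exists y; rewrite ?IH // mem_lr_cut Syx xV yV.
rewrite subv_cap lr_root_inf_subr lr_root_c_inf andbT.
apply: subv_trans VinfP _; rewrite -(lr_root_inf_subr P l).
exact: subv_trans (lr_root_inf_sub ranP) (lr_rootS (lr_subS l sPS)).
Qed.

Lemma lr_root_c_subr S l : lr_root_c (lr_sub S l) = lr_root_c S.
Proof.
apply/eqP; rewrite eqEsubv lr_root_c_subr_le andbT.
by rewrite -{2}(lr_sub_subr S l) lr_root_c_subr_le.
Qed.

Lemma lr_exp_inv S k : lr_exp (lr_inv S) k = lr_inv (lr_exp S k).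
Proof.
elim: k => [|k IH]; apply: vspace_iffP => -[x z].
  by rewrite mem_lr_inv !mem_lr_id eq_sym.
rewrite mem_lr_inv [X in _ <-> X]mem_lr_expSr [X in X <-> _]mem_lr_comp.
rewrite -/(lr_exp _ k) IH.
by split=> -[y]; exists y; rewrite ?mem_lr_inv // -mem_lr_inv.
Qed.

Lemma lr_mul_exp_inv S k : mulx (lr_inv S) k = kerx S k.
Proof. by rewrite lr_exp_inv lr_mul_inv. Qed.

Lemma lr_root_c_inv S : lr_root_c (lr_inv S) = lr_root_c S.
Proof.
by rewrite /lr_root_c !lr_rootE /lr_root_inf !lr_exp_inv lr_mul_inv lr_ker_inv capvC.
Qed.

(** Reduces everything about W to A; the content is the invariance of R_c
    under translation and inversion. *)
Lemma weyrW_invE S l k : weyrW_nth S l k = weyrA_nth (lr_inv (lr_sub S l)) k.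
Proof.
by rewrite /weyrA_nth !lr_mul_exp_inv lr_root_c_inv lr_root_c_subr.
Qed.

End Shift.

(** * The sequences are non-increasing *)
Section Monotone.
Variables (K : fieldType) (X : vectType K).
Implicit Types (S : linrel X) (l : K) (x y z : X) (k : nat).

(** A_(k+2) is an entry of the restriction of S to D = dom S, hence the
    dimension of a quotient (V :&: D) / (U :&: D), which embeds in V / U. *)
Lemma weyrA_nonincr S k : (weyrA_nth S k.+2 <= weyrA_nth S k.+1)%N.
Proof.
rewrite -weyrA_restr; have := weyrA_dim S k; have := weyrA_dim (lr_restr S) k.
rewrite !lr_mul_exp_restr lr_root_c_restr.
rewrite ![(_ :&: lr_dom S)%VS]capvC !(vspace_modr _ (lr_root_c_dom S)).
set U := (mulx S k + _)%VS; set V := (mulx S k.+1 + _)%VS; set D := lr_dom S.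
have sUV : (U <= V)%VS by rewrite addvS ?lr_mul_exp_sub.
have := dim_add_modular D sUV; have := dimv_sum_cap U D; have := dimv_sum_cap V D.
have := dimvS (addvS sUV (subvv D)).
rewrite ![(D :&: _)%VS]capvC; lia.
Qed.

Lemma weyrW_nonincr S l k : (weyrW_nth S l k.+2 <= weyrW_nth S l k.+1)%N.
Proof. by rewrite !weyrW_invE weyrA_nonincr. Qed.

(** S induces an isomorphism between the quotient defining B_(k+2) and the
    image modulo mul S of the quotient defining B_(k+1), because vectors of R_c
    have predecessors in R_c and successors are only determined modulo mul S. *)
Lemma weyrB_transfer S k (M := (lr_mul S :&: lr_root_c S)%VS) :
  (\dim (kerx S k.+2 :&: lr_root_c S) + \dim (kerx S k :&: lr_root_c S + M) =
   \dim (kerx S k.+1 :&: lr_root_c S + M) + \dim (kerx S k.+1 :&: lr_root_c S))%N.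
Proof.
apply: (@lr_dim_transfer _ _ S) => [| |x|y|x y Sxy].
- by rewrite capvS // lr_ker_exp_sub.
- by rewrite addvS // capvS // lr_ker_exp_sub.
- rewrite memv_cap => /andP[/lr_ker_expS[y Sxy yk] xR]; exists y => //.
  rewrite mem_addl // memv_cap yk memv_cap.
  rewrite (subvP (lr_ker_exp_root S k.+1)) //=.
  by rewrite (lr_root_inf_succ Sxy) ?(subvP (lr_root_c_inf S)).
- case/memv_addP=> n; rewrite memv_cap => /andP[nk nR] [m].
  rewrite memv_cap => /andP[mM _] ->.
  have [x xR Sxn] := lr_root_c_pred nR; exists x; last exact: lr_mem_mul.
  by rewrite memv_cap xR andbT; apply/lr_ker_expS; exists n.
have sV j : (kerx S j :&: lr_root_c S + M <= lr_root_c S)%VS.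
  by rewrite subv_add !capvSr.
rewrite memv_cap => /andP[_ xR] /(subvP (sV _)) yR; rewrite memv_cap xR andbT.
apply/idP/idP=> [/lr_ker_expS[y' Sxy' y'k]|/memv_addP[n]].
  have y'R : y' \in lr_root_c S.
    rewrite memv_cap (subvP (lr_ker_exp_root S k)) //=.
    by rewrite (lr_root_inf_succ Sxy') ?(subvP (lr_root_c_inf S)).
  rewrite -[y](subrK y') memvD //; last by rewrite mem_addl // memv_cap y'k.
  by rewrite mem_addr // memv_cap (lr_mem_eq Sxy) ?memvB.
rewrite memv_cap => /andP[nk _] [m]; rewrite memv_cap => /andP[mM _] yE.
apply/lr_ker_expS; exists n => //.
by have := lr_mem_mul Sxy (_ : - m \in _); rewrite memvN yE addrK => /(_ mM).
Qed.

Lemma weyrB_nonincr S k : (weyrB_nth S k.+2 <= weyrB_nth S k.+1)%N.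
Proof.
have := weyrB_transfer S k; have := weyrB_dim S k; have := weyrB_dim S k.+1.
have := dim_add_modular (lr_mul S :&: lr_root_c S)
  (capvS (lr_ker_exp_sub S k) (subvv (lr_root_c S))).
lia.
Qed.

Lemma weyrC_nonincr S k : (weyrC_nth S k.+2 <= weyrC_nth S k.+1)%N.
Proof.
have := weyrC_dim S k; have := weyrC_dim S k.+1.
have := dimvS (addvS (lr_dom_exp_sub S k.+1) (subvv (lr_ran S))); lia.
Qed.

End Monotone.

(** * Recovering the entries from the nonzero ones *)
Section Sequences.

Lemma nth_filter_nonzero (s : seq nat) j :
  sorted geq s -> nth 0%N [seq c <- s | c != 0%N] j = nth 0%N s j.
Proof.
elim: s j => // x s IH j xs; have ss := path_sorted xs.
have [x0|x0] := eqVneq x 0%N; last by rewrite /= x0; case: j => //= j; apply: IH.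
have s0 i : nth 0%N (x :: s) i = 0%N.
  case: i => //= i; have [lti|] := ltnP i (size s); last exact: nth_default.
  have /allP/(_ _ (mem_nth 0%N lti)) := order_path_min (rev_trans leq_trans) xs.
  by rewrite x0 /= leqn0 => /eqP.
rewrite s0 /= x0 /= IH //; exact: (s0 j.+1).
Qed.

(** In a non-increasing sequence the zero entries come last. *)
Lemma nonzero_entries_inj n (a b : nat -> nat) :
  (forall k, a k.+2 <= a k.+1)%N -> (forall k, b k.+2 <= b k.+1)%N ->
  (forall k, (n < k)%N -> a k = 0%N) -> (forall k, (n < k)%N -> b k = 0%N) ->
  nonzero_entries n a = nonzero_entries n b -> forall k, a k.+1 = b k.+1.
Proof.
move=> am bm a0 b0 eqab k; have [ltkn|lenk] := ltnP k n; last by rewrite a0 ?b0.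
have nthE c : (forall k, c k.+2 <= c k.+1)%N ->
    nth 0%N (nonzero_entries n c) k = c k.+1.
  move=> cm; rewrite nth_filter_nonzero.
    by rewrite (nth_map 0%N) ?size_iota // nth_iota.
  have srt m i : sorted geq [seq c j | j <- iota i.+1 m].
    elim: m i => //= -[|m] IH i //=.
    by apply/andP; split; [apply: cm | apply: (IH i.+1)].
  exact: srt.
by rewrite -!nthE ?eqab.
Qed.

End Sequences.

(** * Images of relations under linear maps *)
Section Transport.
Variables (K : fieldType) (X : vectType K) (f : 'End(X)).
Implicit Types (S : linrel X) (l : K) (x y z : X) (k : nat).

Lemma lr_dom_map S : lr_dom (lr_map f S) = (f @: lr_dom S)%VS.
Proof.
rewrite /lr_dom /lr_map -!limg_comp; apply: eq_in_limg => p _.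
by rewrite !comp_lfunE !lfunE.
Qed.

Lemma lr_ran_map S : lr_ran (lr_map f S) = (f @: lr_ran S)%VS.
Proof.
rewrite /lr_ran /lr_map -!limg_comp; apply: eq_in_limg => p _.
by rewrite !comp_lfunE !lfunE.
Qed.

Lemma lr_sub_map S l : lr_sub (lr_map f S) l = lr_map f (lr_sub S l).
Proof.
rewrite /lr_sub /lr_map -!limg_comp; apply: eq_in_limg => p _.
rewrite !comp_lfunE !lfunE; congr pair => /=.
by rewrite -(linearZ_LR f) -(linearB f).
Qed.

Lemma lr_inv_map S : lr_inv (lr_map f S) = lr_map f (lr_inv S).
Proof.
rewrite /lr_inv /lr_map -!limg_comp; apply: eq_in_limg => p _.
by rewrite !comp_lfunE !lfunE.
Qed.

(** When the kernel of f is mul S, a successor may be replaced by any other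
    vector with the same image, so chains in the image of S lift to chains. *)
Lemma lr_ker_exp_quot S k : lker f = lr_mul S ->
  kerx (lr_map f S) k = (f @: kerx S k)%VS.
Proof.
move=> fM; elim: k => [|k IH]; first by rewrite !lr_ker_exp0 limg0.
apply: vspace_iffP => a; rewrite lr_ker_expS IH; split=> [[b]|].
  case/mem_lr_map=> -[x y] [/= Sxy -> ->] /memv_imgP[y' y'k eqy].
  apply/memv_imgP; exists x => //; apply/lr_ker_expS; exists y' => //.
  rewrite -[y'](subrKC y) lr_mem_mul // -fM memv_ker linearB /= eqy.
  by rewrite subrr.
case/memv_imgP=> x /lr_ker_expS[y Sxy yk] ->.
by exists (f y); [apply: lr_map_mem | apply: memv_img].
Qed.

(** The first vector of a chain of S starting from 0 is killed by f, whence
    the shift of the exponent. *)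
Lemma lr_mul_exp_quot S k : lker f = lr_mul S ->
  mulx (lr_map f S) k = (f @: mulx S k.+1)%VS.
Proof.
move=> fM; elim: k => [|k IH].
  apply/eqP; rewrite lr_mul_exp0 lr_exp1 eq_sym -lkerE fM; exact: subvv.
apply: vspace_iffP => b; rewrite lr_mul_expS IH; split=> [[a]|].
  case/memv_imgP=> x' x'k -> /mem_lr_map[[x y] [/= Sxy eqx ->]].
  apply/memv_img/(@lr_mul_expS _ _ S k.+1); exists x => //.
  rewrite -[x](subrK x') memvD //.
  rewrite (subvP (lr_mul_sub_exp S k)) // -fM memv_ker linearB /=.
  by rewrite eqx subrr.
case/memv_imgP=> z /lr_mul_expS[y yk Syz] ->.
by exists (f y); [apply: memv_img | apply: lr_map_mem].
Qed.

Hypothesis f0 : lker f == 0%VS.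

Lemma lr_ker_map S : lr_ker (lr_map f S) = (f @: lr_ker S)%VS.
Proof.
apply: vspace_iffP => a; rewrite mem_lr_ker; split=> [/mem_lr_map[[x y] /= [Sxy -> ]]|].
  rewrite -[LHS](linear0 f) => /(lker0P f0) y0.
  by rewrite memv_img // mem_lr_ker y0.
case/memv_imgP=> x; rewrite mem_lr_ker => /(lr_map_mem f) Sx ->.
by rewrite -[0](linear0 f).
Qed.

Lemma lr_mul_map S : lr_mul (lr_map f S) = (f @: lr_mul S)%VS.
Proof. by rewrite -!lr_ker_inv lr_inv_map lr_ker_map. Qed.

Lemma lr_exp_mapS S k : lr_exp (lr_map f S) k.+1 = lr_map f (lr_exp S k.+1).
Proof.
elim: k => [|k IH]; first by rewrite !lr_exp1.
apply: vspace_iffP => -[a c]; rewrite mem_lr_map mem_lr_comp.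
rewrite -/(lr_exp _ k.+1) IH; split=> [[b /mem_lr_map[[x y] [/= Sxy -> ->]]]|].
  case/mem_lr_map=> -[y' z] [/= Syz /(lker0P f0) eqy ->]; exists (x, z); split=> //.
  by apply/mem_lr_comp; exists y; rewrite ?eqy // -eqy.
case=> -[x z] [/mem_lr_comp[y Sxy Syz] /= -> ->].
by exists (f y); apply: lr_map_mem.
Qed.

Lemma lr_ker_exp_map S k : kerx (lr_map f S) k = (f @: kerx S k)%VS.
Proof.
case: k => [|k]; first by rewrite !lr_ker_exp0 limg0.
by rewrite lr_exp_mapS lr_ker_map.
Qed.

Lemma lr_mul_exp_map S k : mulx (lr_map f S) k = (f @: mulx S k)%VS.
Proof. by rewrite -!lr_ker_inv -!lr_exp_inv lr_inv_map lr_ker_exp_map. Qed.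

End Transport.

(** * Isomorphisms and their lifting from the restriction *)
Section Isomorphism.
Variables (K : fieldType) (X : vectType K).
Implicit Types (S : linrel X) (f g h : 'End(X)) (U V : {vspace X}) (l : K).
Implicit Types (x y z : X) (k : nat).

(** Strict equivalence, stated with endomorphisms instead of matrices. *)
Definition lr_iso S1 S2 : Prop := exists2 f, lker f == 0%VS & lr_map f S1 = S2.

Lemma lr_iso_by f S1 S2 : lker f == 0%VS -> \dim S1 = \dim S2 ->
  (forall x y, (x, y) \in S1 -> (f x, f y) \in S2) -> lr_iso S1 S2.
Proof.
move=> f0 eqd fS; exists f => //; apply/eqP; rewrite eqEdim lr_dim_map // eqd leqnn.
by rewrite andbT; apply: linrel_sub => x y /mem_lr_map[[a b] [/fS Sab -> ->]].
Qed.

Lemma lr_iso_dim S1 S2 : lr_iso S1 S2 ->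
  [/\ \dim S1 = \dim S2, \dim (lr_dom S1) = \dim (lr_dom S2)
    & \dim (lr_mul S1) = \dim (lr_mul S2)].
Proof.
case=> f f0 <-; rewrite lr_dim_map // lr_dom_map lr_mul_map //.
by rewrite !(lker0_dim _ f0).
Qed.

Lemma lfun_extend U V U' f : lker f == 0%VS -> (U <= V)%VS -> (f @: U <= U')%VS ->
  \dim V = \dim U' ->
  exists g, [/\ lker g == 0%VS, {in U, g =1 f} & (g @: V = U')%VS].
Proof.
move=> f0 sUV sfU eqd; pose C := (V :\: U)%VS.
have VE : (C + U = V)%VS by rewrite addv_diff; apply/addv_idPl.
have [h hE] : exists h : 'End(X), (h @: C = U' :\: f @: U)%VS.
  apply: iso_eqdim; have := qdimE sUV; have := qdimE sfU.
  by rewrite /qdim (lker0_dim _ f0) -/C; lia.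
have [k [kh kf]] := lfun_glue h f (capv_diff V U).
have kV : (k @: V = U')%VS.
  rewrite -VE limgD (eq_in_limg kh) (eq_in_limg kf) hE addv_diff.
  exact/addv_idPl.
have [|g g0 gk] := @lfun_ext_inj _ _ V k.
  have /eqP : (V :&: lker k = 0)%VS.
    apply/eqP; rewrite -dimv_eq0; have := limg_ker_dim k V; rewrite kV; lia.
  rewrite -subv0 => /subvP k0 x xV kx0.
  by apply/eqP; rewrite -memv0 k0 // memv_cap xV memv_ker kx0 eqxx.
exists g; split=> // [x xU|]; last by rewrite (eq_in_limg gk).
by rewrite gk ?kf ?(subvP sUV).
Qed.

Lemma lr_pairs_mem f g U u : u \in U -> (f u, g u) \in lr_pairs f g U.
Proof. by move=> uU; apply/mem_lr_pairs; exists u. Qed.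

(** Let f carry the restriction of S1 to that of S2; it may be assumed to carry
    dom S1 to dom S2.  Put E for a complement of the domain of the restriction
    in dom S1, and s1, s2 for sections of S1, S2.  The successors s1 e of
    vectors e in E are independent modulo dom S1 + mul S1, for otherwise e
    would have a successor in dom S1.  So f can be redefined outside dom S1 by
    sending s1 e to s2 (f e) and mul S1 to mul S2. *)
Lemma lr_iso_restr S1 S2 :
  lr_iso (lr_restr S1) (lr_restr S2) -> \dim (lr_dom S1) = \dim (lr_dom S2) ->
  \dim (lr_mul S1) = \dim (lr_mul S2) -> lr_iso S1 S2.
Proof.
move=> isoR eqD eqM; have [_ _ eqMr] := lr_iso_dim isoR.
have sW S : (lr_dom (lr_restr S) + lr_ran (lr_restr S) <= lr_dom S)%VS.
  rewrite subv_add lr_ran_restr capvSr andbT.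
  by apply/subvP=> x /mem_lr_dom[y]; rewrite mem_lr_restr => /andP[/lr_domP].
case: isoR => f0 f00 f0R.
have [|f [f0' ff0 fD]] := lfun_extend f00 (sW S1) _ eqD.
  by rewrite limgD -lr_dom_map -lr_ran_map f0R.
have fI := lker0P f0'.
have fR x y : (x, y) \in lr_restr S1 -> (f x, f y) \in lr_restr S2.
  move=> Rxy; rewrite !ff0 -?f0R ?lr_map_mem //.
    by rewrite mem_addr // (lr_ranP Rxy).
  by rewrite mem_addl // (lr_domP Rxy).
have fdR : (f @: lr_dom (lr_restr S1) = lr_dom (lr_restr S2))%VS.
  by rewrite -f0R lr_dom_map; apply: eq_in_limg => x xD; rewrite ff0 // mem_addl.
have [s1 s1P] := lr_section S1; have [s2 s2P] := lr_section S2.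
pose E := (lr_dom S1 :\: lr_dom (lr_restr S1))%VS.
pose C1 := (lr_mul S1 :\: lr_dom S1)%VS; pose C2 := (lr_mul S2 :\: lr_dom S2)%VS.
have dimC : \dim C1 = \dim C2.
  have := dimv_cap_compl (lr_mul S1) (lr_dom S1).
  have := dimv_cap_compl (lr_mul S2) (lr_dom S2).
  by rewrite -!lr_mul_restr -/C1 -/C2; lia.
have [h hC] := iso_eqdim dimC.
(* The graph of the required map on dom S1 + ran S1.  The extra summand C1
   takes care of the part of mul S1 outside dom S1. *)
pose G : linrel X := (lr_pairs \1%VF f (lr_dom S1) + lr_pairs s1 (s2 \o f)%VF E
            + lr_pairs \1%VF h C1)%VS.
have sED e : e \in E -> e \in lr_dom S1 by apply/subvP/diffvSl.
have fDm d : d \in lr_dom S1 -> f d \in lr_dom S2 by rewrite -fD; apply: memv_img.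
have hCm c : c \in C1 -> h c \in C2 by rewrite -hC; apply: memv_img.
have sCM1 c : c \in C1 -> c \in lr_mul S1 by apply/subvP/diffvSl.
have sCM2 c : c \in C2 -> c \in lr_mul S2 by apply/subvP/diffvSl.
have memG d e c : d \in lr_dom S1 -> e \in E -> c \in C1 ->
    (d + s1 e + c, f d + s2 (f e) + h c) \in G.
  move=> dD eE cC.
  have -> : (d + s1 e + c, f d + s2 (f e) + h c) =
    ((\1%VF : 'End(X)) d, f d) + (s1 e, (s2 \o f)%VF e) + ((\1%VF : 'End(X)) c, h c).
    by rewrite !id_lfunE comp_lfunE.
  by rewrite !memv_add // lr_pairs_mem.
have inG x y : (x, y) \in G -> exists d e c, [/\ d \in lr_dom S1, e \in E, c \in C1,
    x = d + s1 e + c & y = f d + s2 (f e) + h c].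
  case/memv_addP=> -[a1 b1] /memv_addP[[a2 b2] /mem_lr_pairs[d dD [-> ->]]].
  case=> -[a3 b3] /mem_lr_pairs[e eE [-> ->]] [-> ->].
  case=> -[a4 b4] /mem_lr_pairs[c cC [-> ->]] [-> ->].
  by exists d, e, c; rewrite !id_lfunE comp_lfunE.
have disj U V x : x \in (U :\: V)%VS -> x \in V -> x = 0.
  by move=> xC xV; apply/eqP; rewrite -memv0 -(capv_diff U V) memv_cap xC.
have mulG : lr_mul G = 0%VS.
  apply/eqP; rewrite -subv0; apply/subvP=> y; rewrite mem_lr_mul => /inG.
  case=> d [e [c [dD eE cC x0 yE]]].
  have ed : s1 e + c = - d by apply/eqP; rewrite -addr_eq0 addrC addrA -x0.
  have e0 : e = 0.
    apply: (disj _ _ _ eE); apply: (@lr_domP _ _ _ _ (- d)).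
    rewrite mem_lr_restr memvN dD -ed andbT.
    by apply: lr_mem_mul _ (sCM1 c cC); apply/s1P/sED.
  move: ed x0 yE; rewrite e0 !linear0 add0r !addr0 => ed x0 ->.
  have c0 : c = 0 by apply: (disj _ _ _ cC); rewrite ed memvN.
  move: x0; rewrite c0 addr0 => <-.
  by rewrite !linear0 addr0 mem0v.
have kerG : lr_ker G = 0%VS.
  apply/eqP; rewrite -subv0; apply/subvP=> x; rewrite mem_lr_ker => /inG.
  case=> d [e [c [dD eE cC xE y0]]].
  have ed : s2 (f e) + h c = - f d by apply/eqP; rewrite -addr_eq0 addrC addrA -y0.
  have e0 : e = 0.
    apply: (disj _ _ _ eE); suff : f e \in lr_dom (lr_restr S2).
      by rewrite -fdR => /memv_imgP[e' e'D /fI->].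
    apply: (@lr_domP _ _ _ _ (- f d)).
    rewrite mem_lr_restr memvN fDm // -ed andbT.
    by apply: lr_mem_mul _ (sCM2 _ (hCm c cC)); apply/s2P/fDm/sED.
  move: ed xE y0; rewrite e0 !linear0 add0r !addr0 => ed -> y0.
  have hc0 : h c = 0 by apply: (disj _ _ _ (hCm c cC)); rewrite ed memvN fDm.
  have c0 : c = 0.
    have /eqP : (C1 :&: lker h = 0)%VS.
      apply/eqP; rewrite -dimv_eq0; have := limg_ker_dim h C1; rewrite hC; lia.
    rewrite -subv0 => /subvP/(_ c); rewrite memv_cap cC memv_ker hc0 eqxx memv0.
    by move=> /(_ isT)/eqP.
  move: y0; rewrite hc0 addr0 c0 addr0 -[LHS](linear0 f) => /fI <-.
  exact: mem0v.
have [|g g0 gG] := @lr_iso_section _ _ G.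
  by have := dim_dom_mul G; have := dim_ran_ker G; rewrite mulG kerG; lia.
have gE x y : (x, y) \in G -> g x = y.
  move=> Gxy; have := lr_mem_eq (gG _ (lr_domP Gxy)) Gxy.
  by rewrite mulG memv0 subr_eq0 => /eqP.
apply: (lr_iso_by g0) => [|x y Sxy].
  by rewrite -(dim_dom_mul S1) -(dim_dom_mul S2) eqD eqM.
have xD := lr_domP Sxy.
have : x \in (E + lr_dom (lr_restr S1))%VS.
  by rewrite addv_diff mem_addl.
case/memv_addP=> e eE [d /mem_lr_dom[d' Rdd'] xE].
have [Sdd' d'D] : (d, d') \in S1 /\ d' \in lr_dom S1.
  by move: Rdd'; rewrite mem_lr_restr => /andP.
have : y - (s1 e + d') \in lr_mul S1.
  by apply: lr_mem_eq Sxy _; rewrite xE; apply: lr_memD => //; apply/s1P/sED.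
rewrite -{1}(addv_diff_cap (lr_mul S1) (lr_dom S1)) -lr_mul_restr -/C1.
case/memv_addP=> c cC [c' c'R yE].
have c'D : c' \in lr_dom S1 by move: c'R; rewrite lr_mul_restr memv_cap => /andP[].
have -> : g x = f x.
  by apply: gE; have := memG x 0 0 xD (mem0v _) (mem0v _); rewrite !linear0 !addr0.
have yE' : y = (d' + c') + s1 e + c.
  rewrite -[y](subrK (s1 e + d')) yE addrACA addrC.
  by rewrite [c' + _]addrC [c + _]addrC addrA.
rewrite {1}yE' (gE _ _ (memG _ _ _ (memvD d'D c'D) eE cC)) xE !linearD /=.
have Sc' : (0, f c') \in S2.
  have : (0, c') \in lr_restr S1 by rewrite -mem_lr_mul.
  by move/fR; rewrite linear0 mem_lr_restr => /andP[].
have Sc : (0, h c) \in S2 by rewrite -mem_lr_mul sCM2 ?hCm.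
have Se : (f e, s2 (f e)) \in S2 by rewrite s2P ?fDm ?sED.
have Sd : (f d, f d') \in S2 by have := fR _ _ Rdd'; rewrite mem_lr_restr => /andP[].
have := lr_memD (lr_memD (lr_memD Sd Sc') Se) Sc.
by rewrite !addr0 [f d + _]addrC.
Qed.

End Isomorphism.

(** * Reduction modulo the multivalued part *)
Section Quotient.
Variables (K : fieldType) (X : vectType K).
Implicit Types (S : linrel X) (f g h : 'End(X)) (U V : {vspace X}) (l : K).
Implicit Types (x y z : X) (k : nat).

(** A projection along mul S: its image, a complement of mul S in X, stands
    for the quotient space, so that the reduced relation lives in X again. *)
Definition lr_pi S : 'End(X) := \1%VF - projv (lr_mul S).

Definition lr_quot S : linrel X := lr_map (lr_pi S) S.

Lemma lker_lr_pi S : lker (lr_pi S) = lr_mul S.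
Proof.
apply/vspaceP=> x; rewrite memv_ker add_lfunE opp_lfunE id_lfunE subr_eq0.
by apply/eqP/idP=> [->|/projv_id->]; rewrite ?memv_proj.
Qed.

Lemma lr_pi_eq S x y : (lr_pi S x == lr_pi S y) = (x - y \in lr_mul S).
Proof. by rewrite -lker_lr_pi memv_ker linearB subr_eq0. Qed.

Lemma dim_lr_pi S U : (\dim (lr_pi S @: U) + \dim (lr_mul S) = \dim (U + lr_mul S))%N.
Proof.
have := limg_ker_dim (lr_pi S) U; rewrite lker_lr_pi.
have := dimv_sum_cap U (lr_mul S); lia.
Qed.

Lemma lr_mul_ran S : (lr_mul S <= lr_ran S)%VS.
Proof. by apply/subvP=> x; rewrite mem_lr_mul => /lr_ranP. Qed.

Lemma lr_quot_dim S : lr_mul S != 0%VS -> (\dim (lr_quot S) < \dim S)%N.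
Proof.
move=> M0; have := limg_ker_dim (linfun (lfmap2 (lr_pi S))) S.
rewrite -/(lr_quot S) => <-; rewrite -[X in (X < _)%N]add0n ltn_add2r lt0n dimv_eq0.
apply: contra M0 => /eqP N0; rewrite -subv0; apply/subvP=> m mM; rewrite memv0.
have : (0, m) \in (S :&: lker (linfun (lfmap2 (lr_pi S))))%VS.
  rewrite memv_cap -mem_lr_mul mM memv_ker lfunE; apply/eqP; congr pair => /=.
    exact: linear0.
  by apply/eqP; rewrite -memv_ker lker_lr_pi.
by rewrite N0 memv0 => /eqP[->].
Qed.

(** Modulo mul S, each x of dom S has a single successor, the class of s x for
    a section s.  The images allowed for x are those compatible with f on the
    class of x and on the class of its successor; an injective map that makes
    allowed choices everywhere respects the relations. *)
Lemma lr_iso_quot S1 S2 :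
  (lr_ran S1 <= lr_dom S1)%VS -> (lr_ran S2 <= lr_dom S2)%VS ->
  \dim (lr_mul S1) = \dim (lr_mul S2) ->
  lr_iso (lr_quot S1) (lr_quot S2) -> lr_iso S1 S2.
Proof.
move=> sRD1 sRD2 eqM isoQ; have [_ eqDQ _] := lr_iso_dim isoQ.
case: isoQ => f f0 fQ; have fI := lker0P f0.
have eqD : \dim (lr_dom S1) = \dim (lr_dom S2).
  move: eqDQ; rewrite !lr_dom_map.
  have := dim_lr_pi S1 (lr_dom S1); have := dim_lr_pi S2 (lr_dom S2).
  rewrite !(addv_idPl _) ?(subv_trans (lr_mul_ran _)) //; lia.
have [s1 s1P] := lr_section S1; have [s2 s2P] := lr_section S2.
set p1 := lr_pi S1 in fQ *; set p2 := lr_pi S2 in fQ *.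
have ps1 x y : (x, y) \in S1 -> p1 y = p1 (s1 x).
  by move=> Sxy; apply/eqP; rewrite lr_pi_eq (lr_mem_eq Sxy) ?s1P ?(lr_domP Sxy).
have ps2 x y : (x, y) \in S2 -> p2 y = p2 (s2 x).
  by move=> Sxy; apply/eqP; rewrite lr_pi_eq (lr_mem_eq Sxy) ?s2P ?(lr_domP Sxy).
pose F : 'Hom((X * X)%type, X) := (f \o p1 \o linfun fst)%VF - (p2 \o linfun snd)%VF.
pose H : 'Hom((X * X)%type, X) :=
  (f \o p1 \o s1 \o linfun fst)%VF - (p2 \o s2 \o linfun snd)%VF.
pose G : linrel X := lr_cut (lker F :&: lker H)%VS (lr_dom S1) (lr_dom S2).
have memG x y : ((x, y) \in G) = [&& x \in lr_dom S1, y \in lr_dom S2,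
    f (p1 x) == p2 y & f (p1 (s1 x)) == p2 (s2 y)].
  have FE : F (x, y) = f (p1 x) - p2 y.
    by rewrite /F add_lfunE opp_lfunE !comp_lfunE !lfunE.
  have HE : H (x, y) = f (p1 (s1 x)) - p2 (s2 y).
    by rewrite /H add_lfunE opp_lfunE !comp_lfunE !lfunE.
  by rewrite mem_lr_cut memv_cap !memv_ker FE HE !subr_eq0 andbC -andbA.
have domG : lr_dom G = lr_dom S1.
  apply: vspace_iffP => x; rewrite mem_lr_dom; split=> [[y]|xD].
    by rewrite memG => /and4P[].
  have : (f (p1 x), f (p1 (s1 x))) \in lr_quot S2.
    by rewrite -fQ; do 2!apply: lr_map_mem; apply: s1P.
  case/mem_lr_map=> -[x2 y2] [/= S2xy ex ey]; exists x2.
  by rewrite memG xD (lr_domP S2xy) ex ey (ps2 _ _ S2xy) !eqxx.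
have ranG : lr_ran G = lr_dom S2.
  apply: vspace_iffP => y; rewrite mem_lr_ran; split=> [[x]|yD].
    by rewrite memG => /and4P[].
  have : (p2 y, p2 (s2 y)) \in lr_quot S2 by apply/lr_map_mem/s2P.
  rewrite -fQ => /mem_lr_map[[a b] [/= /mem_lr_map[[x1 y1] [/= S1xy -> ->]] ex ey]].
  by exists x1; rewrite memG yD (lr_domP S1xy) ex ey (ps1 _ _ S1xy) !eqxx.
have [|g g0 gG] := @lr_iso_section _ _ G; first by rewrite domG ranG.
apply: (lr_iso_by g0) => [|x y Sxy].
  by rewrite -(dim_dom_mul S1) -(dim_dom_mul S2) eqD eqM.
have xD := lr_domP Sxy; have yD := subvP sRD1 _ (lr_ranP Sxy).
have := gG x; have := gG y; rewrite domG xD yD !memG.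
move=> /(_ isT)/and4P[_ gyD /eqP ey _] /(_ isT)/and4P[_ gxD _ /eqP ex].
have : g y - s2 (g x) \in lr_mul S2.
  by rewrite -lr_pi_eq -/p2 -ey -ex (ps1 _ _ Sxy).
by move=> /(lr_mem_mul (s2P _ gxD)); rewrite addrC subrK.
Qed.

Section QuotientEntries.
Variable S : linrel X.
Hypothesis sMR : (lr_mul S <= lr_root_c S)%VS.

Lemma lr_root_c_quot : lr_root_c (lr_quot S) = (lr_pi S @: lr_root_c S)%VS.
Proof.
have pM := lker_lr_pi S; rewrite {1}/lr_root_c lr_rootE lr_ker_exp_quot //.
rewrite -lr_rootE {1}/lr_root_inf lr_mul_exp_quot // lr_mul_exp_stable ?leqnSn //.
rewrite -/(lr_root_inf S).
apply/eqP; rewrite eqEsubv limg_cap andbT; apply/subvP=> a.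
rewrite memv_cap => /andP[/memv_imgP[x xR ->] /memv_imgP[x' x'R /eqP]].
rewrite lr_pi_eq => /(subvP sMR)/(subvP (lr_root_c_inf S)) xx'.
by rewrite memv_img // memv_cap xR -[x](subrK x') memvD.
Qed.

Lemma weyrW_quot l k : weyrW_nth (lr_quot S) l k.+1 = weyrW_nth S l k.+1.
Proof.
have mulE : lr_mul (lr_sub S l) = lr_mul S.
  by have := lr_mul_exp_subr S l 1; rewrite !lr_exp1.
have pM : lker (lr_pi S) = lr_mul (lr_sub S l) by rewrite mulE lker_lr_pi.
have := weyrW_dim (lr_quot S) l k; have := weyrW_dim S l k.
rewrite lr_sub_map !lr_ker_exp_quot // lr_root_c_quot -!limgD.
have dimE j := dim_lr_pi S (kerx (lr_sub S l) j + lr_root_c S).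
have := dimE k; have := dimE k.+1; rewrite -!addvA !(addv_idPl sMR); lia.
Qed.

Lemma weyrB_quot k : weyrB_nth (lr_quot S) k.+1 = weyrB_nth S k.+2.
Proof.
have pM := lker_lr_pi S.
have capE j : (kerx (lr_quot S) j :&: lr_root_c (lr_quot S) =
               lr_pi S @: (kerx S j :&: lr_root_c S))%VS.
  rewrite lr_root_c_quot lr_ker_exp_quot //.
  apply/eqP; rewrite eqEsubv limg_cap andbT; apply/subvP=> a.
  rewrite memv_cap => /andP[/memv_imgP[x xk ->] /memv_imgP[x' x'R /eqP]].
  rewrite lr_pi_eq => /(subvP sMR) xx'.
  by rewrite memv_img // memv_cap xk -[x](subrK x') memvD.
have := weyrB_dim (lr_quot S) k; have := weyrB_dim S k.+1; rewrite !capE.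
have := weyrB_transfer S k; rewrite (capv_idPl sMR).
have dimE j := dim_lr_pi S (kerx S j :&: lr_root_c S).
have := dimE k; have := dimE k.+1; lia.
Qed.

End QuotientEntries.

Lemma lr_ran_quot S :
  (lr_ran S <= lr_dom S)%VS -> (lr_ran (lr_quot S) <= lr_dom (lr_quot S))%VS.
Proof. by move=> sRD; rewrite lr_ran_map lr_dom_map limgS. Qed.

End Quotient.

(** * Eigenvalues of operators *)
Section Eigenvalues.

Lemma lr_eigenvalue_exists (K : closedFieldType) (X : vectType K) (S : linrel X) :
  (lr_ran S <= lr_dom S)%VS -> lr_mul S = 0%VS -> lr_dom S != 0%VS ->
  exists l, lr_eigenvalue S l.
Proof.
move=> sRD M0 D0; have [s sP] := lr_section S; set D := lr_dom S in sRD D0 sP *.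
pose g : 'End(subvs_of D) := (linfun (vsproj D) \o s \o linfun vsval)%VF.
have gE u : vsval (g u) = s (vsval u).
  rewrite !comp_lfunE !lfunE /= vsprojK //.
  by apply/(subvP sRD)/(lr_ranP (sP _ (subvsP u))).
set e := vbasis {:subvs_of D}.
have n0 : (0 < \dim {:subvs_of D})%N by rewrite dimvf /dim /= lt0n dimv_eq0.
pose A := passmx.mxof e e g.
have [l] : exists l, root (char_poly A) l.
  by apply/closed_rootP; rewrite size_char_poly eqSS -lt0n.
rewrite -eigenvalue_root_char => /eigenvalueP[v vA v0].
have eb : basis_of {:subvs_of D} e := vbasisP _.
exists l; apply/negP=> /eqP N0; case/negP: v0.
pose u := passmx.vecof e v.
have gu : g u = l *: u.
  rewrite /u (passmx.hom_vecof e eb) -/A vA.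
  by rewrite scaler_sumr; apply: eq_bigr => i _; rewrite mxE scalerA.
have : vsval u \in lr_ker (lr_sub S l).
  rewrite mem_lr_ker; apply/mem_lr_sub; exists (s (vsval u)); first exact/sP/subvsP.
  by rewrite -gE gu subrr.
rewrite N0 memv0 => /eqP u0.
rewrite -(passmx.vecof_eq0 eb) -/u; apply/eqP/subvs_inj.
by rewrite u0 linear0.
Qed.

End Eigenvalues.

(** * Restriction of an operator to the range of S - l *)
Section Operators.
Variables (K : fieldType) (X : vectType K).
Implicit Types (S : linrel X) (U V : {vspace X}) (l mu : K) (x y z : X) (k : nat).

Lemma nonincr_eq0 (a : nat -> nat) :
  a 1 = 0%N -> (forall k, a k.+2 <= a k.+1)%N -> forall k, a k.+1 = 0%N.
Proof. by move=> a1 am; elim=> // k IH; apply/eqP; rewrite -leqn0 -IH. Qed.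

Lemma weyrA_eq0 S k : (lr_ran S <= lr_dom S)%VS -> weyrA_nth S k.+1 = 0%N.
Proof.
rewrite ran_sub_dom addn_eq0 => /andP[/eqP A1 _].
exact: nonincr_eq0 A1 (weyrA_nonincr S) k.
Qed.

Lemma weyrC_eq0 S k : (lr_ran S <= lr_dom S)%VS -> weyrC_nth S k.+1 = 0%N.
Proof.
rewrite ran_sub_dom addn_eq0 => /andP[_ /eqP C1].
exact: nonincr_eq0 C1 (weyrC_nonincr S) k.
Qed.

Lemma weyrB_eq0 S k : lr_mul S = 0%VS -> weyrB_nth S k.+1 = 0%N.
Proof.
move=> M0; apply: (nonincr_eq0 _ (weyrB_nonincr S)).
by rewrite weyrB1 M0 cap0v dimv0.
Qed.

Lemma lr_root_c_eq0 S : lr_mul S = 0%VS -> lr_root_c S = 0%VS.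
Proof.
move=> M0; rewrite /lr_root_c; suff -> : lr_root_inf S = 0%VS by rewrite capv0.
rewrite /lr_root_inf; elim: (\dim _) => [|k IH]; first exact: lr_mul_exp0.
apply/eqP; rewrite -subv0; apply/subvP=> z /lr_mul_expS[y].
by rewrite IH memv0 => /eqP->; rewrite -mem_lr_mul M0.
Qed.

Lemma weyrW1 S l : lr_mul S = 0%VS -> weyrW_nth S l 1 = \dim (lr_ker (lr_sub S l)).
Proof.
move=> M0; have := weyrW_dim S l 0.
by rewrite (lr_root_c_eq0 M0) !addv0 lr_ker_exp0 dimv0 addn0 lr_exp1.
Qed.

Definition lr_restr_ran S l : linrel X :=
  lr_cut S (lr_ran (lr_sub S l)) (lr_ran (lr_sub S l)).

(** This identity makes the reduction for operators an instance of the
    restriction to the domain. *)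
Lemma lr_restr_ran_inv S l :
  lr_inv (lr_sub (lr_restr_ran S l) l) = lr_restr (lr_inv (lr_sub S l)).
Proof.
apply: vspace_iffP => -[x y]; rewrite mem_lr_restr !mem_lr_inv lr_dom_inv mem_lr_sub.
split=> [[w]|/andP[Syx yR]].
  rewrite mem_lr_cut => /and3P[Syw yR _] ->; rewrite yR andbT.
  by apply/mem_lr_sub; exists w.
have /mem_lr_sub[w Syw xE] := Syx; exists w => //.
by rewrite mem_lr_cut Syw yR -[w](subrK (l *: y)) -xE memvD ?memvZ ?(lr_ranP Syx).
Qed.

Section EigenvalueRestriction.
Variables (S : linrel X) (l : K).
Hypotheses (sRD : (lr_ran S <= lr_dom S)%VS) (M0 : lr_mul S = 0%VS).

Lemma lr_ran_sub_dom : (lr_ran (lr_sub S l) <= lr_dom S)%VS.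
Proof.
apply/subvP=> y /mem_lr_ran[x /mem_lr_sub[w Sxw ->]].
by rewrite memvB ?memvZ ?(lr_domP Sxw) ?(subvP sRD) ?(lr_ranP Sxw).
Qed.

Lemma lr_dom_restr_ran : lr_dom (lr_restr_ran S l) = lr_ran (lr_sub S l).
Proof.
apply: vspace_iffP => x; rewrite mem_lr_dom; split=> [[y]|xR].
  by rewrite mem_lr_cut => /and3P[].
have /mem_lr_dom[y Sxy] := subvP lr_ran_sub_dom _ xR; exists y.
rewrite mem_lr_cut Sxy xR -[y](subrK (l *: x)) memvD ?memvZ //.
by apply/mem_lr_ran; exists x; apply/mem_lr_sub; exists y.
Qed.

Lemma lr_ran_restr_ran : (lr_ran (lr_restr_ran S l) <= lr_dom (lr_restr_ran S l))%VS.
Proof.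
rewrite lr_dom_restr_ran; apply/subvP=> y /mem_lr_ran[x].
by rewrite mem_lr_cut => /and3P[].
Qed.

Lemma lr_restr_ran_sub : (lr_restr_ran S l <= S)%VS.
Proof. by apply: linrel_sub => x y; rewrite mem_lr_cut => /and3P[]. Qed.

Lemma lr_mul_restr_ran : lr_mul (lr_restr_ran S l) = 0%VS.
Proof.
apply/eqP; rewrite -subv0 -M0; apply/subvP=> y; rewrite !mem_lr_mul.
exact: subvP lr_restr_ran_sub _.
Qed.

Lemma lr_restr_ran_dim : lr_eigenvalue S l -> (\dim (lr_restr_ran S l) < \dim S)%N.
Proof.
rewrite /lr_eigenvalue -dimv_eq0 => N0.
have := dim_dom_mul (lr_restr_ran S l); have := dim_dom_mul S.
rewrite lr_mul_restr_ran M0 lr_dom_restr_ran !dimv0 !addn0 => <- <-.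
have := dim_dom_mul (lr_sub S l); have := dim_ran_ker (lr_sub S l).
have -> : lr_mul (lr_sub S l) = 0%VS.
  by have := lr_mul_exp_subr S l 1; rewrite !lr_exp1 M0.
rewrite lr_dom_sub dimv0; lia.
Qed.

Lemma weyrW_restr_ran k : weyrW_nth (lr_restr_ran S l) l k.+1 = weyrW_nth S l k.+2.
Proof. by rewrite !weyrW_invE lr_restr_ran_inv weyrA_restr. Qed.

(** Chains of S - mu that end in 0 are contained in the range of S - l: if y is
    the successor of x in such a chain and y is in that range, then so is
    (mu - l) x. *)
Lemma weyrW_restr_ran_neq mu k : mu != l ->
  weyrW_nth (lr_restr_ran S l) mu k = weyrW_nth S mu k.
Proof.
move=> neq; have kerE j : kerx (lr_sub (lr_restr_ran S l) mu) j = kerx (lr_sub S mu) j.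
  have sR i x : x \in kerx (lr_sub S mu) i -> x \in lr_ran (lr_sub S l).
    elim: i x => [|i IH] x; first by rewrite lr_ker_exp0 memv0 => /eqP->; rewrite mem0v.
    case/lr_ker_expS=> y /mem_lr_sub[w Sxw yE] /IH yR.
    have : (mu - l) *: x \in lr_ran (lr_sub S l).
      have -> : (mu - l) *: x = (w - l *: x) - y.
        by rewrite yE opprB [RHS]addrC addrA subrK scalerBl.
      by rewrite memvB //; apply/mem_lr_ran; exists x; apply/mem_lr_sub; exists w.
    by move=> /(memvZ (mu - l)^-1); rewrite scalerA mulVf ?scale1r // subr_eq0.
  elim: j => [|j IH]; first by rewrite !lr_ker_exp0.
  apply: vspace_iffP => x; split=> /[dup] xk /lr_ker_expS[y].
    case/mem_lr_sub=> w /(subvP lr_restr_ran_sub) Sxw yE; rewrite IH => yk.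
    by apply/lr_ker_expS; exists y => //; apply/mem_lr_sub; exists w.
  case/mem_lr_sub=> w Sxw yE yk; apply/lr_ker_expS; exists y; rewrite ?IH //.
  apply/mem_lr_sub; exists w => //; rewrite mem_lr_cut Sxw (sR _ _ xk).
  by rewrite -[w](subrK (mu *: x)) -yE memvD ?memvZ ?(sR _ _ yk) ?(sR _ _ xk).
by rewrite /weyrW_nth !kerE (lr_root_c_eq0 M0) (lr_root_c_eq0 lr_mul_restr_ran).
Qed.

End EigenvalueRestriction.

Lemma lr_iso_inv_sub S1 S2 l :
  lr_iso (lr_inv (lr_sub S1 l)) (lr_inv (lr_sub S2 l)) -> lr_iso S1 S2.
Proof.
have invK S : lr_inv (lr_inv S) = S by apply: linrelP => x y; rewrite !mem_lr_inv.
case=> f f0 fE; exists f => //.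
rewrite -(lr_sub_subr S1 l) -(lr_sub_subr S2 l) -lr_sub_map; congr lr_sub.
by rewrite -[LHS]invK lr_inv_map fE invK.
Qed.

Lemma lr_iso_inv S1 S2 l : lr_iso S1 S2 ->
  lr_iso (lr_inv (lr_sub S1 l)) (lr_inv (lr_sub S2 l)).
Proof. by case=> f f0 <-; exists f => //; rewrite -lr_inv_map lr_sub_map. Qed.

Lemma lr_iso_restr_ran S1 S2 l :
  (lr_ran S1 <= lr_dom S1)%VS -> (lr_ran S2 <= lr_dom S2)%VS ->
  lr_mul S1 = 0%VS -> lr_mul S2 = 0%VS ->
  weyrW_nth S1 l 1 = weyrW_nth S2 l 1 ->
  lr_iso (lr_restr_ran S1 l) (lr_restr_ran S2 l) -> lr_iso S1 S2.
Proof.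
move=> sRD1 sRD2 M1 M2 eqW iso; apply: (@lr_iso_inv_sub _ _ l).
have [_ eqD _] := lr_iso_dim iso; apply: lr_iso_restr.
- by rewrite -!lr_restr_ran_inv; apply: lr_iso_inv.
- by rewrite !lr_dom_inv -!lr_dom_restr_ran.
- by rewrite !lr_mul_inv -!weyrW1.
Qed.

End Operators.

(** * The entries determine the relation *)
Section Classification.
Variables (K : closedFieldType) (X : vectType K).
Implicit Types (S : linrel X) (l : K) (k : nat).

(** Coincidence of the Weyr characteristics before dropping zero entries; this
    form is stable under the reductions, and quantifies over all scalars so
    that eigenvalues need not be matched. *)
Definition same_entries (F : fieldType) (Y : vectType F) (S1 S2 : linrel Y) : Prop :=
  [/\ forall (l : F) k, weyrW_nth S1 l k.+1 = weyrW_nth S2 l k.+1,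
      forall k, weyrA_nth S1 k.+1 = weyrA_nth S2 k.+1,
      forall k, weyrB_nth S1 k.+1 = weyrB_nth S2 k.+1
    & forall k, weyrC_nth S1 k.+1 = weyrC_nth S2 k.+1].

(** Whether ran S <= dom S, whether mul S = 0, and which l are eigenvalues of
    an operator can be read off the entries, so that S1 and S2 always undergo
    the same reduction. *)
Theorem lr_iso_of_entries S1 S2 : same_entries S1 S2 -> lr_iso S1 S2.
Proof.
have [n] := ubnP (\dim S1); elim: n S1 S2 => // n IH S1 S2 /ltnSE ledn.
case=> eqW eqA eqB eqC.
have [sRD1|nsRD1] := boolP (lr_ran S1 <= lr_dom S1)%VS; last first.
  have isoR : lr_iso (lr_restr S1) (lr_restr S2).
    apply: IH.
      apply: leq_trans ledn; rewrite ltnNge; apply: contra nsRD1 => leS.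
      have /eqP SE : lr_restr S1 == S1.
        rewrite eqEdim leS andbT; apply: linrel_sub => x y.
        by rewrite mem_lr_restr => /andP[].
      apply/subvP=> y /mem_lr_ran[x]; rewrite -{1}SE mem_lr_restr.
      by case/andP.
    split=> [l k|k|k|k]; first by rewrite !weyrW_restr.
    - by rewrite !weyrA_restr.
    - by rewrite !weyrB_restr.
    - by rewrite !weyrC_restr.
  have [_ eqDr eqMr] := lr_iso_dim isoR; apply: lr_iso_restr => //.
    by rewrite (dim_dom_restr S1) (dim_dom_restr S2) eqDr eqA eqC.
  by have := dim_mul_restr S1; have := dim_mul_restr S2; rewrite !eqA eqMr; lia.
have sRD2 : (lr_ran S2 <= lr_dom S2)%VS by rewrite ran_sub_dom -eqA -eqC -ran_sub_dom.
have sMR1 := weyrA1_eq0 (weyrA_eq0 0 sRD1).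
have sMR2 := weyrA1_eq0 (weyrA_eq0 0 sRD2).
have eqM : \dim (lr_mul S1) = \dim (lr_mul S2).
  by have := eqB 0; rewrite !weyrB1 !(capv_idPl _).
have [M1|M1] := eqVneq (lr_mul S1) 0%VS; last first.
  apply: lr_iso_quot => //; apply: IH; first exact: leq_trans (lr_quot_dim M1) ledn.
  split=> [l k|k|k|k]; first by rewrite !weyrW_quot.
  - by rewrite !weyrA_eq0 ?lr_ran_quot.
  - by rewrite !weyrB_quot.
  - by rewrite !weyrC_eq0 ?lr_ran_quot.
have M2 : lr_mul S2 = 0%VS by apply/eqP; rewrite -dimv_eq0 -eqM M1 dimv0.
have eqE l : lr_eigenvalue S1 l = lr_eigenvalue S2 l.
  by rewrite /lr_eigenvalue -!dimv_eq0 -!weyrW1 // eqW.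
have [[D1 D2]|[l El]] : lr_dom S1 = 0%VS /\ lr_dom S2 = 0%VS \/
    exists l, lr_eigenvalue S1 l.
- have [D1|D1] := eqVneq (lr_dom S1) 0%VS; last by right; apply: lr_eigenvalue_exists.
  have [D2|D2] := eqVneq (lr_dom S2) 0%VS; first by left.
  have [l] := lr_eigenvalue_exists sRD2 M2 D2; rewrite -eqE; by right; exists l.
- have S0 S : lr_mul S = 0%VS -> lr_dom S = 0%VS -> S = 0%VS.
    move=> M0 D0; apply/eqP; rewrite -dimv_eq0 -dim_dom_mul M0 D0 !dimv0; exact: eqxx.
  rewrite (S0 _ M1 D1) (S0 _ M2 D2); exists \1%VF; last exact: limg0.
  by apply/lker0P=> x y; rewrite !id_lfunE.
apply: (lr_iso_restr_ran sRD1 sRD2 M1 M2 (eqW l 0)); apply: IH.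
  exact: leq_trans (lr_restr_ran_dim sRD1 M1 El) ledn.
split=> [mu k|k|k|k].
- have [->|neq] := eqVneq mu l; first by rewrite !weyrW_restr_ran.
  by rewrite !weyrW_restr_ran_neq.
- by rewrite !weyrA_eq0 ?lr_ran_restr_ran.
- by rewrite !weyrB_eq0 ?lr_mul_restr_ran.
- by rewrite !weyrC_eq0 ?lr_ran_restr_ran.
Qed.

End Classification.

(** * Entries and Weyr characteristics *)
Section WeyrCharacteristic.
Variables (K : fieldType) (X : vectType K).
Implicit Types (S : linrel X) (l : K) (k : nat).

Lemma weyrW_not_proper S l k : ~~ lr_proper_eigenvalue S l -> weyrW_nth S l k.+1 = 0%N.
Proof.
move=> nP; have := weyrW_dim S l k; suff sR j : (kerx (lr_sub S l) j <= lr_root_c S)%VS.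
  by rewrite !(addv_idPr (sR _)); lia.
have sRl : (kerx (lr_sub S l) j <= lr_root S l)%VS.
  by apply/subvP=> x xj; apply/mem_lr_root; exists j.
move: nP; rewrite negb_and !negbK => /orP[/eqP N0|]; last exact: subv_trans.
suff -> : kerx (lr_sub S l) j = 0%VS by apply: sub0v.
elim: j {sRl} => [|j IH]; first exact: lr_ker_exp0.
apply/eqP; rewrite -subv0; apply/subvP=> x /lr_ker_expS[y].
by rewrite IH memv0 => Sxy /eqP y0; rewrite -N0 mem_lr_ker -y0.
Qed.

(** The comparison extends from the proper eigenvalues to all scalars because
    the entries of W vanish at the other ones. *)
Lemma same_weyr_same_entries S1 S2 : same_weyr S1 S2 -> same_entries S1 S2.
Proof.
case=> eqP1 eqW eqA eqB eqC; split=> [l|||].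
- have [P1|nP1] := boolP (lr_proper_eigenvalue S1 l); last first.
    by move=> k; rewrite !weyrW_not_proper -?eqP1.
  exact: nonzero_entries_inj (weyrW_nonincr S1 l) (weyrW_nonincr S2 l)
    (weyrW_nth_eq0 S1 l) (weyrW_nth_eq0 S2 l) (eqW l P1).
- exact: nonzero_entries_inj (weyrA_nonincr S1) (weyrA_nonincr S2)
    (weyrA_nth_eq0 S1) (weyrA_nth_eq0 S2) eqA.
- exact: nonzero_entries_inj (weyrB_nonincr S1) (weyrB_nonincr S2)
    (weyrB_nth_eq0 S1) (weyrB_nth_eq0 S2) eqB.
- exact: nonzero_entries_inj (weyrC_nonincr S1) (weyrC_nonincr S2)
    (weyrC_nth_eq0 S1) (weyrC_nth_eq0 S2) eqC.
Qed.

Lemma same_weyr_map (f : 'End(X)) S : lker f == 0%VS -> same_weyr S (lr_map f S).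
Proof.
move=> f0; have qE U V := limg_qdim U V f0.
have rootE l : lr_root (lr_map f S) l = (f @: lr_root S l)%VS.
  by rewrite /lr_root lr_sub_map lr_ker_exp_map.
have rootcE : lr_root_c (lr_map f S) = (f @: lr_root_c S)%VS.
  by rewrite /lr_root_c rootE /lr_root_inf lr_mul_exp_map // lker0_img_cap.
have nzE n (a b : nat -> nat) : (forall k, a k.+1 = b k.+1) ->
    nonzero_entries n a = nonzero_entries n b.
  move=> ab; congr filter; apply/eq_in_map => -[|k] //.
  by rewrite mem_iota.
split=> [l|l _|||].
- rewrite /lr_proper_eigenvalue /lr_eigenvalue lr_sub_map lr_ker_map // rootE rootcE.
  by rewrite limg_ker0 // -!dimv_eq0 (lker0_dim _ f0).
- apply: nzE => k; rewrite /weyrW_nth lr_sub_map !lr_ker_exp_map // rootcE.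
  by rewrite -!limgD qE.
- by apply: nzE => k; rewrite /weyrA_nth !lr_mul_exp_map // rootcE -!limgD qE.
- apply: nzE => k; rewrite /weyrB_nth !lr_ker_exp_map // rootcE.
  by rewrite -!lker0_img_cap // qE.
- apply: nzE => k; rewrite /weyrC_nth rootE !lr_exp_mapS // !lr_ran_map lr_dom_map.
  by rewrite -!limgD !qE.
Qed.

End WeyrCharacteristic.

Lemma lr_iso_strictly_equivalent (K : fieldType) (m : nat) (S1 S2 : linrel 'cV[K]_m) :
  lr_iso S1 S2 <-> strictly_equivalent S1 S2.
Proof.
pose mx (f : 'End('cV[K]_m)) : 'M[K]_m := \matrix_(i, j) f (delta_mx j 0) i 0.
have mxfE f x : mx f *m x = f x.
  rewrite [in RHS](matrix_sum_delta x) linear_sum; apply/colP=> i.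
  rewrite !mxE summxE; apply: eq_bigr => j _.
  by rewrite big_ord1 linearZ !mxE mulrC.
split=> [[f f0 <-]|[T Tu TE]].
  exists (mx f).
    suff /mulmx1_unit[_ //] : mx f^-1%VF *m mx f = 1%:M.
    have colE1 (A : 'M[K]_m) i j : A i j = (A *m delta_mx j 0 : 'cV_m) i 0.
      by rewrite -colE mxE.
    apply/matrixP=> i j; rewrite colE1 [RHS]colE1 mul1mx -mulmxA !mxfE.
    by rewrite lker0_lfunK.
  move=> [a b]; rewrite mem_lr_map; split=> [[p [Sp -> ->]]|[p Sp [-> ->]]].
    by exists p; rewrite ?mxfE.
  by exists p; rewrite ?mxfE.
pose f : 'End('cV[K]_m) := linfun (mulmx T).
have fE x : f x = T *m x by rewrite lfunE.
exists f; first by apply/lker0P=> x y; rewrite !fE => /(can_inj (mulKmx Tu)).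
apply: vspace_iffP => -[a b]; rewrite mem_lr_map TE.
split=> [[p [Sp -> ->]]|[p Sp [-> ->]]]; by exists p; rewrite ?fE.
Qed.

Theorem theorem5p5 (R : realType) (m : nat) (S1 S2 : linrel 'cV[R[i]]_m) :
  same_weyr S1 S2 <-> strictly_equivalent S1 S2.
Proof.
rewrite -lr_iso_strictly_equivalent.
split=> [/same_weyr_same_entries/lr_iso_of_entries //|[f f0 <-]].
exact: same_weyr_map.
Qed.
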